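(* Let $V\sim N(\mu,\Sigma)$ be a Gaussian random vector with positive definite covariance matrix $\Sigma$, let $a\ne c$ and $z$ be components of $V$ and $B$ a set of components of $V$, with $a,c\notin B\cup\{z\}$. Suppose $a\perp\!\!\!\perp z$, and suppose that for some component $x$ of $V$ one of the following two conditions holds: (i) $c\perp\!\!\!\perp\{a,z\}$ and at least one of the following six conditions holds: (a) $\{a,z\}\perp\!\!\!\perp B\mid x$; (b) $\{a,z\}\perp\!\!\!\perp B\mid \{c,x\}$; (c) $\{c,z\}\perp\!\!\!\perp B\mid x$; (d) $\{c,z\}\perp\!\!\!\perp B\mid\{a,x\}$; (e) $\{a,c\}\perp\!\!\!\perp B\mid x$; (f) $\{a,c\}\perp\!\!\!\perp B\mid\{x,z\}$; (ii) $\{a,z\}\perp\!\!\!\perp \{c\}\cup B\mid x$. Then $$\rho^2_{ac\mid B}\le\rho^2_{ac\mid B\cup\{z\}}.$$ Further, if $z'\notin\{a,c\}$ is a component of $V$ with $z'\perp\!\!\!\perp\{a,c\}\cup B\mid z$, then in both cases (i) and (ii) $$\rho^2_{ac\mid B}\le\rho^2_{ac\mid B\cup\{z'\}}\le\rho^2_{ac\mid B\cup\{z\}}.$$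
   Context: $X\perp\!\!\!\perp Y\mid W$ denotes conditional independence of the (sub)vectors $X$ and $Y$ given $W$; for components of a Gaussian vector it is equivalent to $\Sigma_{XY}-\Sigma_{XW}\Sigma_{WW}^{-1}\Sigma_{WY}=0$ (this also makes sense if the sets overlap). $X\perp\!\!\!\perp Y$ is unconditional independence. For distinct components $u,v$ and a set $Z$ of components with $u,v\notin Z$, the squared partial correlation is $$\rho^2_{uv\mid Z}=\frac{(\sigma_{uv}-\Sigma_{uZ}\Sigma_{ZZ}^{-1}\Sigma_{Zv})^2}{(\sigma_{uu}-\Sigma_{uZ}\Sigma_{ZZ}^{-1}\Sigma_{Zu})(\sigma_{vv}-\Sigma_{vZ}\Sigma_{ZZ}^{-1}\Sigma_{Zv})},$$ where $\sigma_{uv}$ is the $(u,v)$ entry of $\Sigma$ and $\Sigma_{uZ}$ etc. are submatrices; for $Z=\emptyset$ the correction terms are absent. *)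

(* Defs.v *)
From HB Require Import structures.
From mathcomp Require Import all_boot all_order all_algebra.
From mathcomp Require Import all_classical all_reals all_analysis.

Set Implicit Arguments.
Unset Strict Implicit.
Unset Printing Implicit Defensive.

Import Order.TTheory GRing.Theory Num.Theory.
Import numFieldNormedType.Exports.

Local Open Scope classical_set_scope.
Local Open Scope ring_scope.

Section covariance_matrix.
Variables (R : realType) (n : nat).
Implicit Types (Sigma : 'M[R]_n) (u v : 'I_n) (X Y Z : {set 'I_n}).

Definition posdef Sigma :=
  Sigma^T = Sigma /\
  forall w : 'rV[R]_n, w != 0 -> 0 < (w *m Sigma *m w^T) 0 0.

Definition subcov Sigma X Y : 'M[R]_(#|X|, #|Y|) :=
  mxsub enum_val enum_val Sigma.

Definition subcov_row Sigma u Z : 'rV[R]_#|Z| :=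
  \row_j Sigma u (enum_val j).

Definition subcov_col Sigma Z v : 'cV[R]_#|Z| :=
  \col_i Sigma (enum_val i) v.

(* For Z = set0 the middle matrix is 0 x 0 and the correction term is 0. *)
Definition partial_cov Sigma u v Z : R :=
  Sigma u v -
  (subcov_row Sigma u Z *m invmx (subcov Sigma Z Z) *m subcov_col Sigma Z v) 0 0.

Definition sq_partial_corr Sigma u v Z : R :=
  partial_cov Sigma u v Z ^+ 2 /
  (partial_cov Sigma u u Z * partial_cov Sigma v v Z).

End covariance_matrix.

Section random_vector.
Context (d : measure_display) (T : measurableType d) (R : realType)
  (P : probability T R).
Implicit Types (E F : set T) (G H : set (set T)).

(* V ~ N(mu, Sigma): every nonzero linear combination w V is univariate normal
   with mean w mu and variance w Sigma w^T. The zero combination is left out,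
   as normal_prob m 0 is not the point mass at m. *)
Definition gaussian_vector (n : nat) (V : 'I_n -> {RV P >-> R})
    (mu : 'cV[R]_n) (Sigma : 'M[R]_n) :=
  forall w : 'rV[R]_n, w != 0 ->
  forall A : set R, measurable A ->
    pushforward P (fun t => \sum_i w 0 i * V i t) A =
    normal_prob ((w *m mu) 0 0) (Num.sqrt ((w *m Sigma *m w^T) 0 0)) A.

Definition sigma_sub (n : nat) (V : 'I_n -> {RV P >-> R}) (X : {set 'I_n}) :
    set (set T) :=
  g_sigma_preimage (fun i : 'I_#|X| => V (enum_val i) : T -> R).

(* f is a version of the conditional probability P(E | H). *)
Definition is_cond_prob H E (f : T -> R) :=
  [/\ forall A : set R, measurable A -> H (f @^-1` A),
      P.-integrable setT (EFin \o f) &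
      forall F, H F -> (\int[P]_(t in F) (f t)%:E = P (E `&` F))%E].

(* P(E `&` F | H) = P(E | H) P(F | H) almost surely. Versions exist and are
   unique up to null sets, so it does not matter which ones are taken. *)
Definition sigma_cond_indep H G1 G2 :=
  forall E F, G1 E -> G2 F ->
  exists f g : T -> R,
    [/\ is_cond_prob H E f, is_cond_prob H F g &
        is_cond_prob H (E `&` F) (fun t => f t * g t)].

Definition sigma_indep G1 G2 :=
  forall E F, G1 E -> G2 F -> (P (E `&` F) = P E * P F)%E.

Definition cond_indep (n : nat) (V : 'I_n -> {RV P >-> R})
    (X Y W : {set 'I_n}) :=
  sigma_cond_indep (sigma_sub V W) (sigma_sub V X) (sigma_sub V Y).

Definition indep (n : nat) (V : 'I_n -> {RV P >-> R}) (X Y : {set 'I_n}) :=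
  sigma_indep (sigma_sub V X) (sigma_sub V Y).

End random_vector.

(* Main.v *)
(** Write s_uv for the partial covariance of u, v given B.  Adding z to B turns
    the squared correlation of a, c into F(1 / s_zz), where
    F(t) = (s_ac - t s_az s_cz)^2 / ((s_aa - t s_az^2) (s_cc - t s_cz^2)),
    while B itself gives F(0) and B with z' gives F(l^2 / s_z'z') for
    l = cov(z', z) / var(z), an intermediate argument.  F is nondecreasing as
    soon as s_ac s_az s_cz <= 0.  Each of the conditions (i)(a)-(f) and (ii) says
    that two of a, z, c are uncorrelated and have proportional covariances with
    B and with the third one, and then s_ac s_az s_cz is minus a square times the
    value of a positive semidefinite form.

    That conditional independence given W forces the partial covariance to
    vanish rests on E[U | W] = 0 for the residual U of V_u after projection on
    W.  Reversing the sign of U does not change the law of any linear combination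
    of U and W, so E[cos (s U + L)] is even in s for every affine function L of W;
    its derivative at s = 0 gives E[U sin L] = 0, and products, bounded limits and
    sign functions of sines generate the sigma-algebra of W.  *)

Require Import Defs.
From HB Require Import structures.
From mathcomp Require Import all_boot all_order all_algebra.
From mathcomp Require Import all_classical all_reals all_analysis.
From mathcomp Require Import ring lra measurable_realfun.

Set Implicit Arguments.
Unset Strict Implicit.
Unset Printing Implicit Defensive.

Import Order.TTheory GRing.Theory Num.Theory.
Import numFieldNormedType.Exports.

Local Open Scope set_scope.
Local Open Scope ring_scope.


(** * Partial covariances *)

Section covariance_algebra.
Variables (R : realType) (n : nat) (Sigma : 'M[R]_n).
Hypothesis Sigma_posdef : posdef Sigma.
Implicit Types (u v j z : 'I_n) (B : {set 'I_n}) (p q r : 'rV[R]_n).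

Let rowBE p q j : (p - q) 0 j = p 0 j - q 0 j.
Proof. by rewrite !mxE. Qed.

Let rowZE (k : R) p j : (k *: p) 0 j = k * p 0 j.
Proof. by rewrite mxE. Qed.

(** Covariance of the linear combinations with coefficient rows [p] and [q]; it serves as the inner
    product in which residuals are orthogonal projections. *)
Definition covform p q : R := (p *m Sigma *m q^T) 0 0.

Lemma covformC p q : covform p q = covform q p.
Proof.
rewrite /covform -[in LHS](trmxK (p *m Sigma *m q^T)) mxE.
by rewrite !trmx_mul trmxK Sigma_posdef.1 mulmxA.
Qed.

Lemma covformDl p q r : covform (p + q) r = covform p r + covform q r.
Proof. by rewrite /covform !mulmxDl mxE. Qed.

Lemma covformZl (k : R) p r : covform (k *: p) r = k * covform p r.
Proof. by rewrite /covform -!scalemxAl mxE. Qed.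

Lemma covformDr p q r : covform p (q + r) = covform p q + covform p r.
Proof. by rewrite ![covform p _]covformC covformDl. Qed.

Lemma covformZr (k : R) p r : covform p (k *: r) = k * covform p r.
Proof. by rewrite ![covform p _]covformC covformZl. Qed.

Lemma covformE p q : covform p q = \sum_j (p *m Sigma) 0 j * q 0 j.
Proof. by rewrite /covform mxE; apply: eq_bigr => j _; rewrite !mxE. Qed.

Lemma covform_deltar p v : covform p (delta_mx 0 v) = (p *m Sigma) 0 v.
Proof.
rewrite covformE (bigD1 v)//= [X in _ * X + _]mxE !eqxx mulr1 big1 ?addr0// => j jv.
by rewrite [X in _ * X]mxE (negbTE jv) andbF mulr0.
Qed.

Lemma covform_gt0 p : p != 0 -> 0 < covform p p.
Proof. exact: Sigma_posdef.2. Qed.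

Lemma covform_ge0 p : 0 <= covform p p.
Proof.
by have [->|/covform_gt0/ltW//] := eqVneq p 0; rewrite /covform !mul0mx mxE.
Qed.

Lemma covform_supp B p q : (forall j, j \notin B -> q 0 j = 0) ->
  (forall j, j \in B -> (p *m Sigma) 0 j = 0) -> covform p q = 0.
Proof.
move=> qB pB; rewrite covformE big1// => j _.
by have [/pB ->|/qB ->] := boolP (j \in B); rewrite ?mul0r ?mulr0.
Qed.

(** Normal equations for the coefficients of V_u minus its linear projection on B. For u in B they
    force the zero row. *)
Definition is_residual u B r :=
  (forall j, j \notin B -> r 0 j = (j == u)%:R) /\
  (forall j, j \in B -> (r *m Sigma) 0 j = 0).

Let sel B : 'M[R]_(#|B|, n) := rowsub enum_val 1%:M.

Let sel_supp B (w : 'rV[R]_#|B|) j : j \notin B -> (w *m sel B) 0 j = 0.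
Proof.
move=> jB; rewrite mxE big1// => i _; rewrite !mxE.
have [ej|_] := eqVneq; last by rewrite mulr0.
by rewrite -ej enum_valP in jB.
Qed.

Let sel_enum_val B (w : 'rV[R]_#|B|) i : (w *m sel B) 0 (enum_val i) = w 0 i.
Proof.
rewrite mxE (bigD1 i)//= !mxE eqxx mulr1 big1 ?addr0// => k ki.
by rewrite !mxE (inj_eq enum_val_inj) (negbTE ki) mulr0.
Qed.

Let mul_selT m B (A : 'M[R]_(m, n)) : A *m (sel B)^T = colsub enum_val A.
Proof. by rewrite trmx_mxsub trmx1 mulmx_colsub mulmx1. Qed.

Let subcovE B : subcov Sigma B B = sel B *m Sigma *m (sel B)^T.
Proof. by rewrite mul_selT mul_rowsub_mx mul1mx; apply/matrixP => i j; rewrite !mxE. Qed.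

Let subcov_rowE u B : subcov_row Sigma u B = delta_mx 0 u *m Sigma *m (sel B)^T.
Proof. by rewrite mul_selT -rowE; apply/matrixP => i j; rewrite !mxE. Qed.

Let subcov_colE v B : subcov_col Sigma B v = sel B *m Sigma *m (delta_mx 0 v)^T.
Proof.
by rewrite trmx_delta -colE mul_rowsub_mx mul1mx; apply/matrixP => i j; rewrite !mxE.
Qed.

(** A nonzero row in the kernel, extended by zeros outside B, would give a nonzero combination of
    variance zero. *)
Lemma subcov_unit B : subcov Sigma B B \in unitmx.
Proof.
rewrite -row_free_unit -kermx_eq0; apply/eqP/row_matrixP => i; rewrite row0.
set w := row i _.
have wS : w *m subcov Sigma B B = 0 by apply/sub_kermxP; exact: row_sub.
apply/eqP; apply: contraT => w0.
have wsel0 : w *m sel B != 0.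
  apply: contra w0 => /eqP h; apply/eqP/rowP => k.
  by rewrite -sel_enum_val h !mxE.
have := covform_gt0 wsel0; rewrite /covform trmx_mul.
rewrite (_ : _ *m _ = w *m subcov Sigma B B *m w^T); last by rewrite subcovE !mulmxA.
by rewrite wS mul0mx mxE ltxx.
Qed.

Definition residual u B : 'rV[R]_n :=
  delta_mx 0 u - subcov_row Sigma u B *m invmx (subcov Sigma B B) *m sel B.

Lemma residualP u B : is_residual u B (residual u B).
Proof.
split=> j jB.
  by rewrite /residual rowBE sel_supp// subr0 mxE.
have : residual u B *m Sigma *m (sel B)^T = 0.
  rewrite /residual !mulmxBl -!mulmxA (mulmxA (sel B)) -subcovE mulVmx ?subcov_unit//.
  by rewrite mulmx1 mulmxA -subcov_rowE subrr.
rewrite mul_selT => /rowP/(_ (enum_rank_in jB j)).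
by rewrite !mxE/= enum_rankK_in.
Qed.

(** The difference of two solutions is supported in B and uncorrelated with B, hence has variance
    zero. *)
Lemma is_residual_uniq u B r r' : is_residual u B r -> is_residual u B r' -> r = r'.
Proof.
move=> [r1 r2] [r1' r2']; apply/eqP; rewrite -subr_eq0; apply: contraT => d0.
have := covform_gt0 d0; rewrite (@covform_supp B) ?ltxx// => j jB.
  by rewrite rowBE r1// r1'// subrr.
by rewrite mulmxBl rowBE r2// r2'// subrr.
Qed.

Lemma partial_cov_residual u v B r : is_residual u B r ->
  (r *m Sigma) 0 v = partial_cov Sigma u v B.
Proof.
move=> /is_residual_uniq/(_ (residualP u B)) ->.
rewrite -covform_deltar /covform /residual !mulmxBl /partial_cov subcov_colE.
rewrite [LHS]mxE [X in _ + X]mxE !mulmxA; congr (_ - _).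
by rewrite -/(covform _ _) covform_deltar -rowE mxE.
Qed.

(** The residual of v differs from V_v by a combination supported in B, with which the residual of u
    is uncorrelated. *)
Lemma partial_cov_covform u v B r r' : is_residual u B r -> is_residual v B r' ->
  partial_cov Sigma u v B = covform r r'.
Proof.
move=> ur vr'; rewrite -(partial_cov_residual v ur) -covform_deltar.
rewrite [RHS]covformC -[r'](subrK (delta_mx 0 v)) covformDl.
rewrite ![covform _ r]covformC [X in X + _](_ : _ = 0) ?add0r//.
apply: (@covform_supp B) => [j jB|]; last exact: ur.2.
by rewrite rowBE vr'.1// mxE eqxx subrr.
Qed.

Lemma partial_covC u v B : partial_cov Sigma u v B = partial_cov Sigma v u B.
Proof.
by rewrite !(partial_cov_covform (residualP _ _) (residualP _ _)) covformC.
Qed.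

Lemma partial_cov_mem u v B : v \in B -> partial_cov Sigma u v B = 0.
Proof.
move=> vB; have ur := residualP u B.
by rewrite -(partial_cov_residual v ur) ur.2.
Qed.

Lemma partial_cov_gt0 u B : u \notin B -> 0 < partial_cov Sigma u u B.
Proof.
move=> uB; rewrite (partial_cov_covform (residualP _ _) (residualP _ _)).
apply: covform_gt0; apply/eqP => /rowP/(_ u).
by rewrite (residualP u B).1// eqxx mxE => /eqP; rewrite oner_eq0.
Qed.

Lemma partial_cov_ge0 u B : 0 <= partial_cov Sigma u u B.
Proof.
rewrite (partial_cov_covform (residualP _ _) (residualP _ _)).
exact: covform_ge0.
Qed.

(** One Gram-Schmidt step: subtracting from the residual of u its projection on the residual of z
    gives the residual for the larger set. For z in B the set does not grow and the correction is
    zero. *)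
Lemma partial_covU1 u v z B :
  partial_cov Sigma u v (z |: B) = partial_cov Sigma u v B -
    partial_cov Sigma u z B * partial_cov Sigma z v B / partial_cov Sigma z z B.
Proof.
have [zB|zB] := boolP (z \in B).
  rewrite [partial_cov _ u z _]partial_cov_mem// !mul0r subr0.
  by rewrite (finset.setUidPr _)// finset.sub1set.
have z0 := partial_cov_gt0 zB.
set k := partial_cov Sigma u z B / partial_cov Sigma z z B.
have ru := residualP u B; have rz := residualP z B.
have h : is_residual u (z |: B) (residual u B - k *: residual z B).
  split=> j; rewrite !inE.
    rewrite negb_or => /andP[jz jB].
    by rewrite rowBE rowZE ru.1// rz.1// (negbTE jz) mulr0 subr0.
  rewrite mulmxBl -scalemxAl => /orP[/eqP ->|jB].
    rewrite rowBE rowZE.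
    by rewrite !(partial_cov_residual _ ru) !(partial_cov_residual _ rz) /k divfK ?subrr// gt_eqF.
  by rewrite rowBE rowZE ru.2// rz.2// mulr0 subr0.
rewrite -(partial_cov_residual v h) mulmxBl -scalemxAl.
rewrite rowBE rowZE.
by rewrite !(partial_cov_residual _ ru) !(partial_cov_residual _ rz) /k mulrAC.
Qed.

Lemma partial_cov0 u v : partial_cov Sigma u v finset.set0 = Sigma u v.
Proof.
have h : is_residual u finset.set0 (delta_mx 0 u).
  by split=> j; rewrite ?inE// mxE eqxx.
by rewrite -(partial_cov_residual v h) -rowE mxE.
Qed.

(** With S = Sigma_BB, Y the restriction of [y] to B, k = Y S^-1 Y^T and q = Y S^-1 Sigma_Bw, the
    three factors are - alpha beta k, alpha (y_w - q) and beta (y_w - q). *)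
Lemma partial_cov_collinear_le0 u v w B (alpha beta : R) (y : 'I_n -> R) :
  Sigma u v = 0 ->
  (forall j, j \in w |: B -> Sigma u j = alpha * y j) ->
  (forall j, j \in w |: B -> Sigma v j = beta * y j) ->
  partial_cov Sigma u v B * partial_cov Sigma u w B * partial_cov Sigma v w B <= 0.
Proof.
move=> uv0 uy vy; have wB : w \in w |: B by rewrite !inE eqxx.
have jB j : j \in B -> j \in w |: B by rewrite !inE => ->; rewrite orbT.
pose Y : 'rV[R]_#|B| := \row_j y (enum_val j).
have rowE t gam : (forall j, j \in w |: B -> Sigma t j = gam * y j) ->
    subcov_row Sigma t B = gam *: Y.
  by move=> h; apply/rowP => j; rewrite !mxE h// jB// enum_valP.
have colE : subcov_col Sigma B v = beta *: Y^T.
  apply/colP => j; rewrite !mxE -(vy _ (jB _ (enum_valP j))).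
  by rewrite -[in LHS]Sigma_posdef.1 mxE.
set S' := invmx (subcov Sigma B B).
pose k := (Y *m S' *m Y^T) 0 0.
pose q := (Y *m S' *m subcov_col Sigma B w) 0 0.
have k0 : 0 <= k.
  (* [k] is the variance of the combination supported in B with coefficients [Y *m S']. *)
  rewrite [k](_ : _ = covform (Y *m S' *m sel B) (Y *m S' *m sel B)) ?covform_ge0//.
  rewrite /covform !trmx_mul -!mulmxA (mulmxA (sel B)) (mulmxA _ (sel B)^T).
  rewrite -subcovE (mulmxA S' (subcov _ _ _)) mulVmx ?subcov_unit// mul1mx.
  have trE (M : 'M[R]_1) : M^T 0 0 = M 0 0 by rewrite mxE.
  by rewrite -[RHS]trE !trmx_mul !trmxK.
have -> : partial_cov Sigma u v B = - (alpha * beta * k).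
  rewrite /partial_cov uv0 sub0r (rowE u alpha)// colE -!scalemxAl -scalemxAr.
  by rewrite scalerA mxE.
have E t gam : (forall j, j \in w |: B -> Sigma t j = gam * y j) ->
    partial_cov Sigma t w B = gam * (y w - q).
  move=> h; rewrite /partial_cov (rowE t gam)// h// -!scalemxAl mxE.
  by rewrite mulrBr.
rewrite (E u alpha)// (E v beta)//.
rewrite (_ : _ * _ = - (k * (alpha * beta * (y w - q)) ^+ 2)); last by ring.
by rewrite oppr_le0 mulr_ge0// sqr_ge0.
Qed.

(** Over W the row of u is Sigma_ux times the indicator row of x, so the correction term scales with
    Sigma_ux. The factor [y] is the same for all such u, which makes their covariances
    proportional. *)
Lemma partial_cov0_factor x (W : {set 'I_n}) : exists y : 'I_n -> R,
  forall u v, (forall j, j \in W -> j != x -> Sigma u j = 0) ->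
    partial_cov Sigma u v W = 0 -> Sigma u v = Sigma u x * y v.
Proof.
pose Ix : 'rV[R]_#|W| := \row_j (enum_val j == x)%:R.
exists (fun v => (Ix *m invmx (subcov Sigma W W) *m subcov_col Sigma W v) 0 0).
move=> u v ux /subr0_eq ->.
rewrite (_ : subcov_row Sigma u W = Sigma u x *: Ix); last first.
  apply/rowP => j; rewrite !mxE; have [->|jx] := eqVneq (enum_val j) x.
    by rewrite mulr1.
  by rewrite mulr0 ux// enum_valP.
by rewrite -!scalemxAl mxE.
Qed.

(** The function F of the overview, with r, p, q for s_ac, s_az, s_cz and A, C for s_aa, s_cc. *)
Let corr_fun (r p q A C t : R) := (r - t * (p * q)) ^+ 2 /
  ((A - t * p ^+ 2) * (C - t * q ^+ 2)).

(** As t grows, the sign of r p q keeps the numerator from decreasing, while both factors of the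
    denominator can only shrink and stay positive. *)
Let corr_fun_le (r p q A C t1 t2 : R) : 0 <= t1 -> t1 <= t2 ->
  t2 * p ^+ 2 < A -> t2 * q ^+ 2 < C -> r * p * q <= 0 ->
  corr_fun r p q A C t1 <= corr_fun r p q A C t2.
Proof.
move=> t10 t12 pA qC rpq; rewrite /corr_fun.
have pt : t1 * p ^+ 2 <= t2 * p ^+ 2 by rewrite ler_wpM2r// sqr_ge0.
have qt : t1 * q ^+ 2 <= t2 * q ^+ 2 by rewrite ler_wpM2r// sqr_ge0.
apply: ler_pM; rewrite ?sqr_ge0// ?invr_ge0.
- by rewrite mulr_ge0// subr_ge0 ltW// (le_lt_trans pt, le_lt_trans qt).
- rewrite -subr_ge0.
  rewrite (_ : _ - _ = (t2 - t1) * ((t1 + t2) * (p * q) ^+ 2 - 2 * (r * p * q))).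
    rewrite mulr_ge0 ?subr_ge0// (@le_trans _ _ 0)//; first by rewrite pmulr_rle0.
    by rewrite mulr_ge0 ?sqr_ge0// addr_ge0// (le_trans t10).
  by ring.
- rewrite lef_pV2 ?posrE ?mulr_gt0 ?subr_gt0// ?(le_lt_trans pt)// ?(le_lt_trans qt)//.
  by apply: ler_pM; rewrite ?lerD2l ?lerN2 ?subr_ge0//; exact: ltW.
Qed.

(** For z', the combination w = V_z' - lambda V_z is uncorrelated with z, a, c and B. Given B, the
    covariances of z' with a and c are therefore lambda times those of z, and its variance is
    lambda^2 s_zz plus the variance of w. So z' evaluates F at a point between 0 and 1 / s_zz. *)
Lemma sq_partial_corr_mono a c z B :
  a \notin z |: B -> c \notin z |: B ->
  partial_cov Sigma a c B * partial_cov Sigma a z B * partial_cov Sigma c z B <= 0 ->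
  sq_partial_corr Sigma a c B <= sq_partial_corr Sigma a c (z |: B) /\
  (forall z' (lambda : R), (forall j, j \in z |: ([set a; c] :|: B) ->
     Sigma z' j = lambda * Sigma z j) ->
     sq_partial_corr Sigma a c B <= sq_partial_corr Sigma a c (z' |: B) /\
     sq_partial_corr Sigma a c (z' |: B) <= sq_partial_corr Sigma a c (z |: B)).
Proof.
move=> azB czB.
set r := partial_cov Sigma a c B; set p := partial_cov Sigma a z B.
set q := partial_cov Sigma c z B; set A := partial_cov Sigma a a B.
set C := partial_cov Sigma c c B; set s := partial_cov Sigma z z B => rpq.
have FB : sq_partial_corr Sigma a c B = corr_fun r p q A C 0.
  by rewrite /corr_fun !mul0r !subr0.
have Fz : sq_partial_corr Sigma a c (z |: B) = corr_fun r p q A C s^-1.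
  rewrite /sq_partial_corr /corr_fun !partial_covU1 (partial_covC z a) (partial_covC z c).
  by rewrite -/r -/p -/q -/A -/C -/s !expr2 !(mulrC s^-1).
have pA : s^-1 * p ^+ 2 < A.
  have := partial_cov_gt0 azB; rewrite partial_covU1 (partial_covC z).
  by rewrite subr_gt0 mulrC.
have qC : s^-1 * q ^+ 2 < C.
  have := partial_cov_gt0 czB; rewrite partial_covU1 (partial_covC z).
  by rewrite subr_gt0 mulrC.
have s0 : 0 <= s := partial_cov_ge0 z B.
have sV0 : 0 <= s^-1 by rewrite invr_ge0.
split=> [|z' lambda z'z]; first by rewrite FB Fz; exact: corr_fun_le.
have [w wdef] : exists w : 'rV[R]_n, w = delta_mx 0 z' - lambda *: delta_mx 0 z by exists (delta_mx 0 z' - lambda *: delta_mx 0 z).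
have wE j : j \in z |: ([set a; c] :|: B) -> (w *m Sigma) 0 j = 0.
  move=> /z'z; rewrite wdef mulmxBl -scalemxAl rowBE rowZE -!rowE !mxE => ->.
  by rewrite subrr.
set s' := partial_cov Sigma z' z' B.
have w0 u : u \in [set a; c] -> covform w (residual u B) = 0.
  move=> uac; apply: (@covform_supp (z |: ([set a; c] :|: B))) => [j|]; last exact: wE.
  rewrite finset.in_setU1 finset.in_setU !negb_or => /and3P[_ jac jB].
  rewrite (residualP u B).1//; case: eqP => // ju.
  by rewrite ju uac in jac.
have covE u : u \in [set a; c] ->
    partial_cov Sigma u z' B = lambda * partial_cov Sigma u z B.
  move=> /w0; rewrite covformC; have ur := residualP u B.
  rewrite -!(partial_cov_residual _ ur) -!covform_deltar !(covformC (residual _ _)).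
  rewrite wdef covformDl -scaleNr covformZl mulNr => /eqP.
  by rewrite subr_eq0 => /eqP.
have jB j : j \in B -> j \in z |: ([set a; c] :|: B).
  by rewrite !inE => ->; rewrite !orbT.
(* This holds for z' in B as well, where the sum is the zero row. *)
have z'r : is_residual z' B (w + lambda *: residual z B).
  have rz := residualP z B; split=> j jnB.
    rewrite wdef mxE rowZE rz.1// rowBE rowZE !mxE/=.
    by rewrite [j == z']eq_sym; rewrite subrK eq_sym.
  by rewrite mulmxDl -scalemxAl mxE rowZE rz.2// wE ?jB// mulr0 addr0.
have s'E : s' = covform w w + lambda ^+ 2 * s.
  have wz : covform w (residual z B) = 0.
    apply: (@covform_supp (z |: ([set a; c] :|: B))) => [j|]; last exact: wE.
    rewrite finset.in_setU1 finset.in_setU !negb_or => /and3P[jz _ jB'].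
    by rewrite (residualP z B).1// (negbTE jz).
  rewrite /s' (partial_cov_covform z'r z'r) covformDl !covformDr !covformZl !covformZr.
  rewrite (covformC _ w) wz -(partial_cov_covform (residualP z B) (residualP z B)) -/s.
  by rewrite !mulr0 addr0 add0r mulrA -expr2.
have Fz' : sq_partial_corr Sigma a c (z' |: B) = corr_fun r p q A C (lambda ^+ 2 / s').
  rewrite /sq_partial_corr /corr_fun !partial_covU1 (partial_covC z' a) (partial_covC z' c).
  rewrite (covE a) ?(covE c) ?inE ?eqxx ?orbT// -/r -/p -/q -/A -/C -/s'.
  congr (_ ^+ 2 / (_ * _)); congr (_ - _); ring.
have s'0 : 0 <= s' := partial_cov_ge0 z' B.
(* For z in B both p and q vanish, so F is constant. *)
have [zB|zB] := boolP (z \in B).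
  rewrite FB Fz Fz' /corr_fun /p /q !partial_cov_mem//.
  by rewrite !(mulr0, mul0r, expr0n, subr0).
have sgt0 : 0 < s := partial_cov_gt0 zB.
have t'0 : 0 <= lambda ^+ 2 / s' by rewrite mulr_ge0 ?sqr_ge0// invr_ge0.
have t'le : lambda ^+ 2 / s' <= s^-1.
  (* [s'] is 0 exactly when z' lies in B; the quotient is then 0 by the convention for inverses, in
     accordance with F(0). *)
  have [->|s'N0] := eqVneq s' 0; first by rewrite invr0 mulr0.
  rewrite ler_pdivrMr ?lt_def ?s'N0// mulrC ler_pdivlMr// s'E lerDr.
  exact: covform_ge0.
rewrite FB Fz Fz'; split; apply: corr_fun_le => //.
  by rewrite (le_lt_trans _ pA)// ler_wpM2r// sqr_ge0.
by rewrite (le_lt_trans _ qC)// ler_wpM2r// sqr_ge0.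
Qed.

End covariance_algebra.

(** * Integrals against the normal law *)

Section normal_integral.
Local Open Scope classical_set_scope.
Variable R : realType.
Local Notation leb := (@lebesgue_measure R).

(** The Radon-Nikodym derivative of the normal law agrees almost everywhere with [normal_pdf], since
    both integrate to the law over every measurable set. *)
Lemma ge0_integral_normal_prob (m s : R) (f : R -> \bar R) :
  (forall x, (0 <= f x)%E) -> measurable_fun setT f ->
  (\int[normal_prob m s]_x f x = \int[leb]_x (f x * (normal_pdf m s x)%:E))%E.
Proof.
move=> f0 mf.
have dom := normal_prob_dominates m s.
rewrite -(Radon_Nikodym_SigmaFinite.change_of_variables dom)//.
have mRN := measurable_int _ (Radon_Nikodym_SigmaFinite.f_integrable dom).
have mpdf : measurable_fun setT (fun x => (normal_pdf m s x)%:E).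
  by apply/measurable_EFinP; exact: measurable_normal_pdf.
apply: ae_eq_integral => //; try exact: emeasurable_funM.
apply: ae_eqe_mul2l; apply: integral_ae_eq => //.
  exact: (Radon_Nikodym_SigmaFinite.f_integrable dom).
by move=> E _ mE; rewrite -Radon_Nikodym_SigmaFinite.f_integral.
Qed.

(** The substitution y = s x + m; its derivative s cancels against the peak of the density, which is
    inversely proportional to s. *)
Lemma ge0_integral_normal_std (m s : R) (g : R -> R) : 0 < s ->
  continuous g -> (forall x, 0 <= g x) ->
  (\int[normal_prob m s]_x (g (x - m))%:E =
   \int[normal_prob 0 1]_x (g (s * x))%:E)%E.
Proof.
move=> s0 cg g0; have mg : measurable_fun setT g by exact: continuous_measurable_fun.
have m1 : measurable_fun setT (fun x : R => (g (x - m))%:E).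
  apply/measurable_EFinP/(measurableT_comp mg).
  by apply: measurable_funB.
have m2 : measurable_fun setT (fun x : R => (g (s * x))%:E).
  by apply/measurable_EFinP/(measurableT_comp mg); exact: mulrl_measurable.
rewrite !ge0_integral_normal_prob//.
pose F (x : R^o) : R^o := s * x + m.
have dF : F^`()%classic = cst s.
  apply/funext => x; rewrite derive1E /F.
  rewrite deriveD// derive_cst addr0 deriveM// derive_cst scaler0 addr0.
  by rewrite derive_id [RHS]/= scaler1.
pose G x := g (x - m) * normal_pdf m s x.
have := @increasing_ge0_integration_by_substitutionT R F G.
rewrite dF => h; apply: etrans (etrans (h _ _ _ _ _ _ _ _ _) _).
- by apply: eq_integral => x _; rewrite -EFinM.
- by move=> x y xy; rewrite /F ltrD2r ltr_pM2l.
- by move=> x; exact: cvg_cst.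
- exact: is_cvg_cst.
- exact: is_cvg_cst.
- by move=> x; rewrite /F.
- apply/cvgrNyPle => A; apply: filterS (nbhs_ninfty_le (num_real (s^-1 * (A - m)))) => x.
  by rewrite /F ler_pdivlMl// lerBrDr.
- apply/cvgryPge => A; apply: filterS (nbhs_pinfty_ge (num_real (s^-1 * (A - m)))) => x.
  by rewrite /F ler_pdivrMl// lerBlDr.
- move=> x; apply: cvgM; last by apply: continuous_normal_pdf; rewrite gt_eqF.
  apply: (@continuous_comp _ _ _ (fun y : R => y - m) g); last exact: cg.
  by apply: cvgB; [exact: cvg_id|exact: cvg_cst].
- by move=> x; rewrite mulr_ge0// normal_pdf_ge0.
- apply: eq_integral => x _; rewrite -EFinM !fctE; congr EFin; rewrite /G /F addrK.
  rewrite -mulrA; congr (_ * _).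
  rewrite (normal_pdfE m) ?gt_eqF// (normal_pdfE 0) ?oner_neq0// /normal_peak /normal_fun addrK.
  rewrite mulrC mulrA; congr (_ * _).
    rewrite -mulrnAr sqrtrM ?sqr_ge0// sqrtr_sqr gtr0_norm// invfM mulrA divff ?gt_eqF//.
    by rewrite mul1r expr1n mul1r.
  congr expR; rewrite subr0 expr1n exprMn !mulNr; congr (- _).
  by rewrite -[s ^+ 2 *+ 2]mulr_natr invfM mulrACA divff ?mul1r// expf_neq0// gt_eqF.
- by move=> x; rewrite lee_fin.
- by move=> x; rewrite lee_fin.
Qed.

End normal_integral.

(** * Integration of products *)

Section bounded_convergence.
Local Open Scope classical_set_scope.
Import HBNNSimple.
Context d (T : measurableType d) (R : realType) (P : probability T R).
Implicit Types (f g h Z : T -> R) (A : set T).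

Local Notation integrableR f := (P.-integrable setT (EFin \o f)).

Lemma integrable_measurable f : integrableR f -> measurable_fun setT f.
Proof. by move=> /(measurable_int P)/measurable_EFinP. Qed.

Lemma integrable_bddM f h (M : R) : integrableR f -> measurable_fun setT h ->
  (forall t, `|h t| <= M) -> integrableR (fun t => f t * h t).
Proof.
move=> If mh hM; rewrite (_ : _ \o _ = (EFin \o f) \* (EFin \o h))%E.
  apply: integrableMl => //; exists M; split; first exact: num_real.
  by move=> x Mx t _ /=; exact: le_trans (hM t) (ltW Mx).
by apply/funext => t /=; rewrite EFinM.
Qed.

Lemma bdd_integrable h (M : R) : measurable_fun setT h ->
  (forall t, `|h t| <= M) -> integrableR h.
Proof.
move=> mh hM; apply: measurable_bounded_integrable => //.
  by rewrite (le_lt_trans (probability_le1 P measurableT))// ltry.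
exists M; split; first exact: num_real.
by move=> x Mx t _ /=; exact: le_trans (hM t) (ltW Mx).
Qed.

Lemma Rintegral_cvg (f_ : nat -> T -> R) f g :
  (forall k, measurable_fun setT (f_ k)) -> measurable_fun setT f ->
  (forall t, f_ k t @[k --> \oo] --> f t) -> integrableR g ->
  (forall k t, `|f_ k t| <= g t) ->
  (\int[P]_t f_ k t) @[k --> \oo] --> \int[P]_t f t.
Proof.
move=> mf_ mf f_f Ig f_g.
have cE : {ae P, forall t, setT t -> (EFin \o f_ k) t @[k --> \oo] --> (EFin \o f) t}.
  apply: aeW => t _; apply: cvg_EFin; last exact: f_f.
  exact: nearW.
have bE : {ae P, forall t k, setT t -> (`|(EFin \o f_ k) t| <= (EFin \o g) t)%E}.
  by apply: aeW => t k _; rewrite lee_fin.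
have mE k : measurable_fun setT (EFin \o f_ k) by exact/measurable_EFinP.
have [If _ cf] := dominated_convergence measurableT mE
  ((measurable_EFinP _ _).2 mf) cE Ig bE.
apply: fine_cvg; rewrite fineK; first exact: cf.
exact: integrable_fin_num.
Qed.

Lemma Rintegral_cvg0 (f_ : nat -> T -> R) f g :
  (forall k, measurable_fun setT (f_ k)) ->
  (forall t, f_ k t @[k --> \oo] --> f t) -> integrableR g ->
  (forall k t, `|f_ k t| <= g t) ->
  (forall k, \int[P]_t f_ k t = 0) -> \int[P]_t f t = 0.
Proof.
move=> mf_ f_f Ig f_g f0.
have mf : measurable_fun setT f by exact: measurable_fun_cvg mf_ (fun t _ => f_f t).
have := Rintegral_cvg mf_ mf f_f Ig f_g.
under eq_fun do rewrite f0.
by move=> /(cvg_unique _ (@cvg_cst _ (0 : R) _ _ _)) => <-.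
Qed.

Lemma Rintegral_sum0 (I : Type) (r : seq I) (F : I -> T -> R) :
  (forall i, integrableR (F i)) -> (forall i, \int[P]_t F i t = 0) ->
  \int[P]_t (\sum_(i <- r) F i t) = 0.
Proof.
move=> IF F0; suff [] : integrableR (fun t => \sum_(i <- r) F i t) /\
    \int[P]_t (\sum_(i <- r) F i t) = 0 by [].
elim: r => [|i r [IH1 IH2]].
  split; last by under eq_Rintegral do rewrite big_nil; rewrite Rintegral_cst// mul0r.
  apply: (@bdd_integrable _ 0) => [|t]; last by rewrite big_nil normr0.
  by under eq_fun do rewrite big_nil; exact: measurable_cst.
split; last first.
  by under eq_Rintegral do rewrite big_cons; rewrite RintegralD// F0 IH2 addr0.
under eq_fun do rewrite /= big_cons.
exact: (integrableD measurableT (IF i) IH1).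
Qed.

(** For simple functions of [h] this is linearity; dominated convergence with bound |Z h| reaches
    nonnegative [h], and positive and negative parts give the general case. It extends orthogonality
    from events to integrable products. *)
Lemma Rintegral_comp0 Z h : integrableR Z -> measurable_fun setT h ->
  integrableR (fun t => Z t * h t) ->
  (forall A : set R, measurable A -> \int[P]_t (Z t * \1_(h @^-1` A) t) = 0) ->
  \int[P]_t (Z t * h t) = 0.
Proof.
have pos (k : T -> R) : integrableR Z -> measurable_fun setT k -> (forall t, 0 <= k t) ->
  integrableR (fun t => Z t * k t) ->
  (forall A : set R, measurable A -> \int[P]_t (Z t * \1_(k @^-1` A) t) = 0) ->
  \int[P]_t (Z t * k t) = 0.
  move=> IZ mk k0 IZk Zk0.
  (* The simple functions approximate the positive part on the real line and are then composed with
     [k], so their level sets pull back to preimages under [k]. *)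
  pose idp : R -> \bar R := fun x => (Num.max x 0)%:E.
  have midp : measurable_fun setT idp.
    by apply/measurable_EFinP; exact: measurable_maxr.
  have idp0 x : setT x -> (0 <= idp x)%E by rewrite lee_fin le_max lexx orbT.
  pose s := nnsfun_approx measurableT midp.
  have idpk t : idp (k t) = (k t)%:E by rewrite /idp max_l.
  have sle i x : ((s i x)%:E <= idp x)%E.
    by rewrite /s nnsfun_approxE; exact: le_approx.
  have s_cvg t : s i (k t) @[i --> \oo] --> k t.
    by have := cvg_nnsfun_approx measurableT midp idp0 (I : setT (k t)); rewrite idpk => /fine_cvg.
  have mks i : measurable_fun setT (fun t => s i (k t)).
    exact: measurableT_comp.
  apply: (@Rintegral_cvg0 (fun i t => Z t * s i (k t)) _ (fun t => `|Z t * k t|)).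
  - by move=> i; apply: measurable_funM => //; exact: integrable_measurable.
  - by move=> t; apply: cvgM; [exact: cvg_cst|exact: s_cvg].
  - exact: integrable_norm.
  - move=> i t; rewrite !normrM ler_wpM2l// !ger0_norm//.
    by rewrite -lee_fin -idpk.
  - move=> i.
    have [N [c cE]] : exists N (c : 'I_N -> R), forall x,
        s i x = \sum_(j < N) (c j * \1_(s i @^-1` [set c j]) x).
      by do 2 eexists; exact: fimfunEord.
    have Ir (j : R) : integrableR (fun t => Z t * (j * \1_(s i @^-1` [set j]) (k t))).
      apply: (@integrable_bddM _ _ `|j|) => //.
        apply: measurable_funM => //; apply: (measurableT_comp _ mk).
        exact: measurable_indic.
      by move=> t; rewrite normrM indicE; case: (_ \in _); rewrite ?normr1 ?normr0 ?mulr1 ?mulr0.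
    transitivity (\int[P]_t (\sum_(j < N) Z t * (c j * \1_(s i @^-1` [set c j]) (k t)))).
      by apply: eq_Rintegral => t _; rewrite {1}cE mulr_sumr.
    apply: Rintegral_sum0 => [j|j]; first exact: Ir.
    under eq_Rintegral do rewrite mulrCA.
    rewrite RintegralZl//; first by rewrite [X in _ * X](Zk0 (s i @^-1` [set c j]) _) ?mulr0.
    apply: (@integrable_bddM _ _ 1) => //.
      apply: (measurableT_comp _ mk); exact: measurable_indic.
    by move=> t; rewrite indicE; case: (_ \in _); rewrite ?normr1 ?normr0.
move=> IZ mh IZh Zh0.
(* Applied below to the positive and the negative part, which are Borel functions of [h] dominated
   by |h|. *)
have half (e : R -> R) : measurable_fun setT e -> (forall x, 0 <= e x <= `|x|) ->
    integrableR (fun t => Z t * e (h t)) /\ \int[P]_t (Z t * e (h t)) = 0.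
  move=> me e0.
  have meh : measurable_fun setT (fun t => e (h t)) by exact: measurableT_comp.
  have IZe : integrableR (fun t => Z t * e (h t)).
    apply: le_integrable IZh => //.
      by apply/measurable_EFinP; apply: measurable_funM => //; exact: integrable_measurable.
    move=> t _; have /andP[e1 e2] := e0 (h t).
    by rewrite /= lee_fin !normrM ler_wpM2l// ger0_norm.
  split => //; apply: (pos (fun t => e (h t))) => // [t|A mA].
    by have /andP[] := e0 (h t).
  rewrite -[RHS](Zh0 (e @^-1` A)) //.
  by rewrite -[X in measurable X]setTI; exact: me.
have [I1 E1] : integrableR (fun t => Z t * Num.max (h t) 0) /\
    \int[P]_t (Z t * Num.max (h t) 0) = 0.
  apply: (half (fun x => Num.max x 0)) => [|x]; first exact: measurable_maxr.
  by rewrite le_max lexx orbT ge_max ler_norm normr_ge0.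
have [I2 E2] : integrableR (fun t => Z t * Num.max (- h t) 0) /\
    \int[P]_t (Z t * Num.max (- h t) 0) = 0.
  apply: (half (fun x => Num.max (- x) 0)) => [|x].
    by apply: measurable_maxr => //; exact: measurableT_comp.
  by rewrite le_max lexx orbT ge_max -normrN ler_norm normr_ge0.
have -> : \int[P]_t (Z t * h t) =
    \int[P]_t (Z t * Num.max (h t) 0 - Z t * Num.max (- h t) 0).
  apply: eq_Rintegral => t _; rewrite -mulrBr; congr (_ * _).
  by rewrite !maxEle; case: (lerP (h t) 0); case: (lerP (- h t) 0) => ? ?; lra.
by rewrite RintegralB// E1 E2 subr0.
Qed.

End bounded_convergence.

(** * Completeness of sines *)

Section sign_limit.
Local Open Scope classical_set_scope.
Variable R : realType.
Implicit Types x y : R.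

(* An odd self-map of [-1, 1] with attracting fixed points 1 and -1, so that its
   iterates are polynomials converging pointwise to the sign function. *)
Definition smoothstep y := y + y * (1 - y ^+ 2) / 2.

Lemma smoothstep_iter_norm_le1 y k : `|y| <= 1 -> `|iter k smoothstep y| <= 1.
Proof.
move=> y1; elim: k => //= k; move: (iter k _ _) => {y y1} y y1.
have [h1 h2] : -1 <= y /\ y <= 1 by apply/andP; rewrite -ler_norml.
(* The distances to -1 and to 1 factor with a square, hence are nonnegative on [-1, 1]. *)
have E1 : smoothstep y - -1 = (1 + y) ^+ 2 * (2 - y) / 2 by rewrite /smoothstep; field.
have E2 : 1 - smoothstep y = (1 - y) ^+ 2 * (2 + y) / 2 by rewrite /smoothstep; field.
by rewrite ler_norml -subr_ge0 -[X in _ && X]subr_ge0 E1 E2 !mulr_ge0 ?sqr_ge0//; lra.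
Qed.

(** The iterates stay in [y, 1], where each step multiplies the distance to 1 by at most 1 - y /
    2. *)
Lemma cvg_smoothstep_pos y : 0 < y -> y <= 1 ->
  iter k smoothstep y @[k --> \oo] --> (1 : R).
Proof.
move=> y0 y1.
have bnd k : y <= iter k smoothstep y /\ iter k smoothstep y <= 1 /\
    1 - iter k smoothstep y <= (1 - y / 2) ^+ k.
  elim: k => [|k] /=; first by rewrite expr0; repeat split => //; lra.
  move: (iter k _ _) => x [xy [x1 xk]]; rewrite exprS.
  have xE : 1 - smoothstep x = (1 - x) * ((1 - x) * (2 + x) / 2).
    by rewrite /smoothstep; field.
  split; first by rewrite /smoothstep -[leLHS]addr0 lerD// !mulr_ge0//; nra.
  split; first by rewrite -subr_ge0 xE !mulr_ge0//; lra.
  have x2 := sqr_ge0 x.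
  have p1 : 0 <= (1 - x) * (2 + x) / 2 by rewrite !mulr_ge0//; lra.
  have p2 : (1 - x) * (2 + x) / 2 <= 1 - y / 2.
    by rewrite (_ : _ / 2 = 1 - x / 2 - x ^+ 2 / 2); [lra|field].
  by rewrite xE mulrC; apply: ler_pM => //; lra.
have c0 : 1 - (1 - y / 2) ^+ k @[k --> \oo] --> (1 - 0 : R).
  apply: cvgB; first exact: cvg_cst.
  by apply: cvg_expr; rewrite ger0_norm; lra.
rewrite subr0 in c0.
apply: (squeeze_cvgr _ c0 (@cvg_cst _ (1 : R) _ _ _)).
by apply: nearW => k; have [_ [-> ?]] := bnd k; rewrite andbT lerBlDl -lerBlDr.
Qed.

Lemma smoothstep_iterN y k : iter k smoothstep (- y) = - iter k smoothstep y.
Proof.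
elim: k => //= k ->; rewrite /smoothstep; ring.
Qed.

Lemma cvg_smoothstep_sg y : `|y| <= 1 ->
  iter k smoothstep y @[k --> \oo] --> Num.sg y.
Proof.
move=> y1; have [y0|y0|->] := ltrgtP y 0.
- rewrite ltr0_sg//; have -> : (fun k => iter k smoothstep y) = (fun k => - iter k smoothstep (- y)).
    by apply/funext => k; rewrite smoothstep_iterN opprK.
  apply: cvgN; apply: cvg_smoothstep_pos; rewrite ?oppr_gt0//.
  by rewrite (le_trans _ y1)// -normrN ler_norm.
- by rewrite gtr0_sg//; apply: cvg_smoothstep_pos => //; rewrite (le_trans (ler_norm y)).
- rewrite sgr0; have -> : (fun k => iter k smoothstep 0) = (fun=> 0 : R).
    by apply/funext; elim=> //= k ->; rewrite /smoothstep mul0r mul0r addr0.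
  exact: cvg_cst.
Qed.

(** Once x / (k + 1) lies between -pi and pi, its sine has the sign of x, so the sequence is
    eventually constant. *)
Lemma cvg_sg_sin x : Num.sg (sin (x / k.+1%:R)) @[k --> \oo] --> Num.sg x.
Proof.
suff pos y : 0 < y -> Num.sg (sin (y / k.+1%:R)) @[k --> \oo] --> (1 : R).
  have [x0|x0|->] := ltrgtP x 0.
  - rewrite ltr0_sg//.
    have -> : (fun k => Num.sg (sin (x / k.+1%:R))) = (fun k => - Num.sg (sin (- x / k.+1%:R))).
      by apply/funext => k; rewrite mulNr sinN sgrN opprK.
    by apply: cvgN; apply: pos; rewrite oppr_gt0.
  - by rewrite gtr0_sg//; exact: pos.
  - have -> : (fun k => Num.sg (sin (0 / k.+1%:R))) = (fun=> Num.sg 0 : R).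
      by apply/funext => k; rewrite mul0r sin0.
    exact: cvg_cst.
move=> y0; apply: cvg_near_cst; near=> k.
apply: gtr0_sg; apply: sin_gt0_pi; rewrite divr_gt0//=.
rewrite ltr_pdivrMr// -ltr_pdivrMl ?pi_gt0//.
apply: (@lt_trans _ _ k%:R); last by rewrite ltr_nat.
by near: k; exact: nbhs_infty_gtr.
Unshelve. all: by end_near. Qed.

End sign_limit.

Section trigonometric_completeness.
Local Open Scope classical_set_scope.
Context d (T : measurableType d) (R : realType) (P : probability T R).
Variables (m : nat) (X : 'I_m -> T -> R) (U : T -> R).
Hypothesis mX : forall j, measurable_fun setT (X j).
Hypothesis IU : P.-integrable setT (EFin \o U).
Implicit Types (c : 'I_m -> R) (theta : R) (f g h : T -> R).

Definition phase c theta t := \sum_j c j * X j t + theta.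

Hypothesis U_sin : forall c theta, \int[P]_t (U t * sin (phase c theta t)) = 0.

Let bdd f := exists M, forall t, `|f t| <= M.

Let test g := [/\ measurable_fun setT g, bdd g &
  forall c theta, \int[P]_t (U t * (g t * sin (phase c theta t))) = 0].

(* Unlike [test], this class is closed under products. *)
Let multiplier f := [/\ measurable_fun setT f, bdd f &
  forall g, test g -> test (fun t => f t * g t)].

Let measurable_phase c theta : measurable_fun setT (phase c theta).
Proof.
apply: measurable_funD => //; apply: measurable_sum => j.
exact: measurable_funM.
Qed.

Let measurable_sin_phase c theta : measurable_fun setT (fun t => sin (phase c theta t)).
Proof.
apply: measurableT_comp => //.
by apply: continuous_measurable_fun; exact: continuous_sin.
Qed.

Let bddM f g : bdd f -> bdd g -> bdd (fun t => f t * g t).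
Proof.
move=> [M fM] [N gN]; exists (M * N) => t; rewrite normrM.
by apply: ler_pM.
Qed.

Let bddD f g : bdd f -> bdd g -> bdd (fun t => f t + g t).
Proof.
move=> [M fM] [N gN]; exists (M + N) => t.
by rewrite (le_trans (ler_normD _ _))// lerD.
Qed.

Let bdd_sin c theta : bdd (fun t => sin (phase c theta t)).
Proof. by exists 1 => t; exact: sin_max. Qed.

Let integrable_test g c theta : measurable_fun setT g -> bdd g ->
  P.-integrable setT (EFin \o (fun t => U t * (g t * sin (phase c theta t)))).
Proof.
move=> mg bg; have [M gM] := bddM bg (bdd_sin c theta).
by apply: integrable_bddM gM => //; exact: measurable_funM.
Qed.

Let test1 : test (fun=> 1).
Proof.
split; [exact: measurable_cst|by exists 1 => t; rewrite normr1|move=> c theta].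
by under eq_Rintegral do rewrite mul1r; exact: U_sin.
Qed.

Let multiplier_cst (k : R) : multiplier (fun=> k).
Proof.
split; [exact: measurable_cst|by exists (Num.norm k)|move=> g [mg bg g0]].
split; [exact: measurable_funM|by apply: bddM => //; exists (Num.norm k)|].
move=> c theta; under eq_Rintegral do rewrite -mulrA mulrCA.
by rewrite RintegralZl ?g0 ?mulr0//; exact: integrable_test.
Qed.

Let multiplierD f h : multiplier f -> multiplier h ->
  multiplier (fun t => f t + h t).
Proof.
move=> [mf bf f0] [mh bh h0]; split; [exact: measurable_funD|exact: bddD|].
move=> g gt; have [mfg bfg fg0] := f0 _ gt; have [mhg bhg hg0] := h0 _ gt.
have [mg bg g0] := gt.
split; [by apply: measurable_funM => //; exact: measurable_funD|by apply: bddM => //; exact: bddD|].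
move=> c theta; under eq_Rintegral do rewrite !mulrDl mulrDr.
rewrite RintegralD ?fg0 ?hg0 ?addr0//; exact: integrable_test.
Qed.

Let multiplierM f h : multiplier f -> multiplier h ->
  multiplier (fun t => f t * h t).
Proof.
move=> [mf bf f0] [mh bh h0]; split; [exact: measurable_funM|exact: bddM|].
by move=> g /h0/f0; under eq_fun do rewrite mulrA.
Qed.

(** The product of two sines is half a difference of cosines of affine functions of X, so the
    integral splits into two that vanish by the choice of test function. *)
Let multiplier_sin c theta : multiplier (fun t => sin (phase c theta t)).
Proof.
split; [exact: measurable_sin_phase|exact: bdd_sin|move=> g [mg bg g0]].
split; [exact: measurable_funM|exact: bddM|move=> c' theta'].
pose c1 j := c j - c' j; pose c2 j := c j + c' j.
have phB t : phase c theta t - phase c' theta' t = phase c1 (theta - theta') t.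
  rewrite /phase opprD addrACA -sumrB; congr (_ + _).
  by apply: eq_bigr => j _; rewrite mulrBl.
have phD t : phase c theta t + phase c' theta' t = phase c2 (theta + theta') t.
  rewrite /phase addrACA -big_split/=; congr (_ + _).
  by apply: eq_bigr => j _; rewrite mulrDl.
(* A cosine is a sine with phase shifted by pi / 2; arbitrary [theta] keeps the class closed under
   this. *)
have cosE c0 th t : cos (phase c0 th t) = sin (phase c0 (th + pi / 2) t).
  by rewrite -sinDpihalf /phase addrA.
have prod t : U t * (sin (phase c theta t) * g t * sin (phase c' theta' t)) =
   2^-1 * (U t * (g t * sin (phase c1 (theta - theta' + pi / 2) t)) -
           U t * (g t * sin (phase c2 (theta + theta' + pi / 2) t))).
  by rewrite -!cosE -phB -phD (cosB (phase _ _ _)) (cosD (phase c theta t) (phase _ _ _)); field.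
under eq_Rintegral do rewrite prod.
rewrite RintegralZl//; last first.
  exact: (integrableB measurableT
    (integrable_test c1 (theta - theta' + pi / 2) mg bg)
    (integrable_test c2 (theta + theta' + pi / 2) mg bg)).
by rewrite RintegralB ?g0 ?subr0 ?mulr0//; exact: integrable_test.
Qed.

(** Dominated convergence, with |U| times the bounds of the sequence and of the test function as
    majorant. *)
Let multiplier_cvg (f_ : nat -> T -> R) f (M : R) :
  (forall k, multiplier (f_ k)) -> (forall k t, `|f_ k t| <= M) ->
  (forall t, f_ k t @[k --> \oo] --> f t) -> multiplier f.
Proof.
move=> f_m f_M f_f.
have mf : measurable_fun setT f.
  by apply: (measurable_fun_cvg _ (fun t _ => f_f t)) => k; have [] := f_m k.
have fM t : `|f t| <= M.
  by apply: (cvgr_to_le (cvg_norm (f_f t))); apply: nearW => k; exact: f_M.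
split=> //; first by exists M.
move=> g gt; have [mg bg g0] := gt.
have bf : bdd f by exists M.
split; [exact: measurable_funM|exact: bddM|move=> c theta].
have [N gN] := bg.
apply: (@Rintegral_cvg0 _ _ _ _ (fun k t => U t * (f_ k t * g t * sin (phase c theta t)))
  _ (fun t => `|U t| * (M * N))).
- move=> k; have [mk _ _] := f_m k.
  apply: measurable_funM; first exact: integrable_measurable IU.
  by apply: measurable_funM => //; exact: measurable_funM.
- move=> t; apply: cvgM; first exact: cvg_cst.
  by apply: cvgM; [apply: cvgM => //|]; exact: cvg_cst.
- apply: (@integrable_bddM _ _ _ _ (fun t => `|U t|) (fun=> M * N) `|M * N|) => //.
  exact: integrable_norm.
- move=> k t; rewrite normrM ler_wpM2l// 2!normrM.
  rewrite -[leRHS]mulr1 ler_pM// ?mulr_ge0//; [exact: ler_pM|exact: sin_max].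
- by move=> k; have [_ _ /(_ _ gt)[_ _]] := f_m k.
Qed.

Let multiplier_sg f : multiplier f -> (forall t, `|f t| <= 1) ->
  multiplier (fun t => Num.sg (f t)).
Proof.
move=> fm f1.
apply: (@multiplier_cvg (fun k t => iter k (@smoothstep R) (f t)) _ 1).
- elim=> // k IH; rewrite /= /smoothstep.
  apply: multiplierD => //.
  under eq_fun do rewrite -mulrA.
  apply: multiplierM => //; apply: multiplierM; last exact: multiplier_cst.
  under eq_fun do rewrite -mulN1r expr2.
  apply: multiplierD; first exact: multiplier_cst.
  apply: multiplierM; first exact: multiplier_cst.
  exact: multiplierM.
- by move=> k t; exact: smoothstep_iter_norm_le1.
- by move=> t; exact: cvg_smoothstep_sg.
Qed.

(** The sign s of X_j - r is the limit of the signs of sin ((X_j - r) / (k + 1)), and the indicator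
    of the ray is (s^2 + s) / 2. *)
Let multiplier_ray j (r : R) : multiplier (\1_(X j @^-1` `]r, +oo[)).
Proof.
have sgm : multiplier (fun t => Num.sg (X j t - r)).
  apply: (@multiplier_cvg (fun k t => Num.sg (sin ((X j t - r) / k.+1%:R))) _ 1).
  - move=> k; apply: multiplier_sg => [|t]; last exact: sin_max.
    have /= := multiplier_sin (fun i => (i == j)%:R / k.+1%:R) (- r / k.+1%:R).
    congr multiplier; apply/funext => t; congr sin.
    rewrite /phase (bigD1 j)//= eqxx big1 => [|i /negbTE ->].
      by rewrite mul1r addr0 mulrBl mulrC mulNr.
    by rewrite !mul0r.
  - by move=> k t; rewrite normr_sg; case: eqP.
  - by move=> t; exact: cvg_sg_sin.
have -> : \1_(X j @^-1` `]r, +oo[) = (fun t => 2^-1 *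
    (Num.sg (X j t - r) * Num.sg (X j t - r) + Num.sg (X j t - r))) :> (T -> R).
  apply/funext => t; rewrite indicE.
  have -> : (t \in X j @^-1` `]r, +oo[) = (r < X j t).
    by apply/idP/idP; rewrite inE/= in_itv/= andbT.
  rewrite -subr_gt0; case: sgrP => _ /=; [by field..|by field|by field].
apply: multiplierM; first exact: multiplier_cst.
by apply: multiplierD => //; exact: multiplierM.
Qed.

Let event (A : set T) := multiplier \1_A.

(** Complements come from 1 - 1_A. The complement of a countable union is the pointwise limit of the
    finite products of the 1 - 1_(F i), which are multipliers. *)
Let event_sigma : sigma_algebra setT event.
Proof.
have evC A : event A -> event (setT `\` A).
  move=> eA; rewrite /event; have -> : \1_(setT `\` A) = (fun t => 1 + -1 * \1_A t) :> (T -> R).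
    apply/funext => t; rewrite setTD !indicE in_setC.
    by case: (t \in A) => /=; rewrite ?mulr1 ?mulr0 ?addr0 ?subrr.
  apply: multiplierD; first exact: multiplier_cst.
  by apply: multiplierM => //; exact: multiplier_cst.
have ev0 : event set0 by rewrite /event indic0; exact: multiplier_cst.
split => // F eF.
rewrite -[\bigcup_i _]setCK -setTD; apply: evC.
pose G k t : R := \prod_(i < k) (1 + -1 * \1_(F i) t).
apply: (@multiplier_cvg G _ 1).
- elim=> [|k IH].
    have -> : G 0 = (fun=> 1) by apply/funext => t; rewrite /G big_ord0.
    exact: multiplier_cst.
  have -> : G k.+1 = (fun t => G k t * (1 + -1 * \1_(F k) t)).
    by apply/funext => t; rewrite /G big_ord_recr.
  apply: multiplierM => //; apply: multiplierD; first exact: multiplier_cst.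
  by apply: multiplierM; [exact: multiplier_cst|exact: eF].
- move=> k t; rewrite /G; elim/big_ind: _ => [|x y x1 y1|i _]; rewrite ?normr1//.
    by rewrite normrM mulr_ile1.
  rewrite indicE; case: (_ \in _); rewrite ?mulr1 ?mulr0 ?subrr ?addr0 ?normr0 ?normr1//.
- move=> t; have [tF|tF] := pselect ((\bigcup_i F i) t).
    rewrite indicE memNset; last by apply.
    have [i _ Fit] := tF; apply: cvg_near_cst; near=> k.
    have ik : (i < k)%N by near: k; exact: nbhs_infty_gt.
    rewrite /G (bigD1 (Ordinal ik))//= indicE mem_set// mulr1 subrr mul0r//.
  rewrite indicE mem_set//; apply: cvg_near_cst; apply: nearW => k.
  rewrite /G big1// => i _; rewrite indicE memNset ?mulr0 ?addr0//.
  by move=> Fit; apply: tF; exists i.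
Unshelve. all: by end_near. Qed.

(** The sets whose indicator is a multiplier form a sigma-algebra containing the preimages of open
    rays, and these rays generate the Borel sets. *)
Lemma Rintegral_indic_sigma0 H : g_sigma_preimage X H ->
  \int[P]_t (U t * \1_H t) = 0.
Proof.
suff evH : g_sigma_preimage X `<=` event.
  (* Zero coefficients and phase pi / 2 turn the sine into the constant 1. *)
  move=> /evH [_ _ /(_ _ test1)[_ _ /(_ (fun=> 0) (pi / 2))]] h.
  rewrite -[RHS]h; apply: eq_Rintegral => t _.
  rewrite /phase big1 ?add0r ?sin_pihalf ?mulr1// => j _; exact: mul0r.
apply: smallest_sub => //.
apply: (@big_ind _ (fun C : set (set T) => C `<=` event)) => //.
  by move=> C D CE DE A [/CE|/DE].
move=> j _ _ [A mA <-]; rewrite setTI.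
have [e0 eC eU] := event_sigma.
have mA' : (R.-ocitv.-measurable).-sigma.-measurable A := mA.
rewrite RGenOInfty.measurableE in mA'.
move: (A) mA'; apply: (@smallest_sub _ _ _ (fun B : set R => event (X j @^-1` B))).
- split; rewrite ?preimage_set0//.
  + by move=> B eB; rewrite setTD preimage_setC -setTD; exact: eC.
  + by move=> F eF; rewrite preimage_bigcup; exact: eU.
- by move=> _ [r ->]; exact: multiplier_ray.
Qed.

End trigonometric_completeness.

(** * Second moment of the standard normal law *)

Section normal_second_moment.
Local Open Scope classical_set_scope.
Variable R : realType.

(* Its value 1 is never needed, only that it is positive and finite: the
   covariances of V are then proportional to Sigma. *)
Definition normal_moment2 : \bar R := (\int[normal_prob (0 : R) 1]_x (x ^+ 2)%:E)%E.

(** From u <= exp u with u = 3 x^2 / 8 follows x^2 exp (- x^2 / 2) <= 8 / 3 exp (- x^2 / 8), and the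
    right side is a multiple of the density with standard deviation 2. The constant [C] also
    exchanges the two peaks. *)
Lemma normal_moment2_lty : (normal_moment2 < +oo)%E.
Proof.
have msq : measurable_fun setT (fun x : R => (x ^+ 2)%:E).
  by apply/measurable_EFinP; exact: measurable_funX.
rewrite /normal_moment2 ge0_integral_normal_prob//; last first.
  by move=> x; rewrite lee_fin sqr_ge0.
pose C : R := 8 / 3 * normal_peak 1 / normal_peak 2.
have C0 : 0 <= C by rewrite /C !mulr_ge0 ?invr_ge0 ?normal_peak_ge0.
apply: (@le_lt_trans _ _ (\int[lebesgue_measure]_x (C%:E * (normal_pdf 0 2 x)%:E))%E).
  apply: ge0_le_integral => //.
  - by move=> x _; rewrite mule_ge0// lee_fin ?sqr_ge0 ?normal_pdf_ge0.
  - apply: emeasurable_funM => //.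
    by apply/measurable_EFinP; exact: measurable_normal_pdf.
  - apply: emeasurable_funM => //.
    by apply/measurable_EFinP; exact: measurable_normal_pdf.
  - move=> x _; rewrite -!EFinM lee_fin.
    rewrite (normal_pdfE _ (oner_neq0 _)) normal_pdfE ?pnatr_eq0//.
    have p20 : normal_peak 2 != 0 :> R by rewrite gt_eqF// normal_peak_gt0// pnatr_eq0.
    rewrite mulrCA (_ : C * _ = normal_peak 1 * (8 / 3 * normal_fun 0 2 x)); last first.
      by rewrite /C; field.
    rewrite ler_wpM2l ?normal_peak_ge0//.
    rewrite /normal_fun subr0.
    have -> : - x ^+ 2 / (1 ^+ 2 *+ 2) = - (3 / 8 * x ^+ 2) + - x ^+ 2 / (2 ^+ 2 *+ 2) by field.
    rewrite expRD mulrA ler_wpM2r ?expR_ge0//.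
    rewrite expRN ler_pdivrMr ?expR_gt0//.
    have := expR_ge1Dx (3 / 8 * x ^+ 2); lra.
rewrite ge0_integralZl//; last 2 first.
- by apply/measurable_EFinP; exact: measurable_normal_pdf.
- by move=> x _; rewrite lee_fin normal_pdf_ge0.
by rewrite integral_normal_pdf mule1 ltry.
Qed.

(** On [1, 2] the integrand is at least the peak of the density times exp (-2). *)
Lemma normal_moment2_gt0 : (0 < normal_moment2)%E.
Proof.
have msq : measurable_fun setT (fun x : R => (x ^+ 2)%:E).
  by apply/measurable_EFinP; exact: measurable_funX.
pose c : R := normal_peak 1 * expR (- 2).
have c0 : 0 < c by rewrite mulr_gt0 ?expR_gt0 ?normal_peak_gt0 ?oner_neq0.
apply: (@lt_le_trans _ _ (\int[lebesgue_measure]_(x in `[1%R, 2%R]) c%:E)%E).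
  rewrite integral_cst//= lebesgue_measure_itv/= lte_fin ltr1n -EFinD -EFinM lte_fin.
  by rewrite mulr_gt0//; lra.
rewrite /normal_moment2 ge0_integral_normal_prob//; last first.
  by move=> x; rewrite lee_fin sqr_ge0.
have mp : measurable_fun setT (fun x : R => ((x ^+ 2)%:E * (normal_pdf 0 1 x)%:E)%E).
  apply: emeasurable_funM => //.
  by apply/measurable_EFinP; exact: measurable_normal_pdf.
apply: (@le_trans _ _ (\int[lebesgue_measure]_(x in `[1%R, 2%R]) ((x ^+ 2)%:E * (normal_pdf 0 1 x)%:E))%E).
  apply: ge0_le_integral => //.
  - by move=> x _; rewrite lee_fin ltW.
  - exact: measurable_funTS.
  - move=> x; rewrite /= in_itv/= => /andP[x1 x2]; rewrite -EFinM lee_fin.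
    rewrite (normal_pdfE _ (oner_neq0 _)) /c /normal_fun subr0.
    rewrite mulrCA ler_wpM2l ?normal_peak_ge0//.
    rewrite -[leLHS]mul1r ler_pM ?expR_ge0//; first nra.
    rewrite ler_expR expr1n; nra.
apply: ge0_subset_integral => //.
by move=> x _; rewrite mule_ge0// lee_fin ?sqr_ge0 ?normal_pdf_ge0.
Qed.

End normal_second_moment.

(** * Gaussian vectors *)

Section gaussian_linear_combinations.
Local Open Scope classical_set_scope.
Context d (T : measurableType d) (R : realType) (P : probability T R).
Variables (n : nat) (V : 'I_n -> {RV P >-> R}) (mu : 'cV[R]_n) (Sigma : 'M[R]_n).
Hypotheses (Sigma_posdef : posdef Sigma) (V_gauss : gaussian_vector V mu Sigma).
Implicit Types (w p q r : 'rV[R]_n) (W : {set 'I_n}).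

Local Notation covf := (covform Sigma).
Local Notation integrableR f := (P.-integrable setT (EFin \o f)).

Definition lincomb w t := \sum_i w 0 i * (V i t - mu i 0).

Lemma lincombE w t : lincomb w t = \sum_i w 0 i * V i t - (w *m mu) 0 0.
Proof.
rewrite mxE -sumrB; apply: eq_bigr => i _; exact: mulrBr.
Qed.

Lemma lincombD p q t : lincomb (p + q) t = lincomb p t + lincomb q t.
Proof.
by rewrite -big_split; apply: eq_bigr => i _; rewrite mxE mulrDl.
Qed.

Lemma lincombZ (k : R) p t : lincomb (k *: p) t = k * lincomb p t.
Proof.
by rewrite mulr_sumr; apply: eq_bigr => i _; rewrite mxE mulrA.
Qed.

Lemma lincomb_delta j t : lincomb (delta_mx 0 j) t = V j t - mu j 0.
Proof.
rewrite /lincomb (bigD1 j)//= mxE !eqxx mul1r big1 ?addr0// => i ij.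
by rewrite mxE (negbTE ij) andbF mul0r.
Qed.

Let measurable_comb w : measurable_fun setT (fun t => \sum_i w 0 i * V i t).
Proof. by apply: measurable_sum => i; exact: measurable_funM. Qed.

Lemma measurable_lincomb w : measurable_fun setT (lincomb w).
Proof.
rewrite (_ : lincomb w = fun t => \sum_i w 0 i * V i t - (w *m mu) 0 0).
  by apply: measurable_funB => //; exact: measurable_comb.
by apply/funext => t; exact: lincombE.
Qed.

(** The right side involves [w] only through its variance, so centred combinations of equal variance
    become interchangeable. *)
Lemma ge0_integral_lincomb w (g : R -> R) : w != 0 -> continuous g ->
  (forall x, 0 <= g x) ->
  (\int[P]_t (g (lincomb w t))%:E =
   \int[normal_prob 0 1]_x (g (Num.sqrt (covf w w) * x))%:E)%E.
Proof.
move=> w0 cg g0; set s := Num.sqrt _; set m := (w *m mu) 0 0.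
have s0 : 0 < s by rewrite sqrtr_gt0 covform_gt0.
have mg : measurable_fun setT (fun x : R => (g (x - m))%:E).
  apply/measurable_EFinP/measurableT_comp.
    by exact: continuous_measurable_fun.
  by apply: measurable_funB.
rewrite -(ge0_integral_normal_std m s0 cg g0).
under eq_integral do rewrite lincombE.
pose S : T -> measurableTypeR R := fun t => \sum_i w 0 i * V i t.
have mS : measurable_fun setT S by exact: measurable_comb.
transitivity (\int[pushforward P S]_x (g (x - m))%:E)%E.
  by rewrite (ge0_integral_pushforward mS P measurableT mg)// => y _; rewrite lee_fin.
apply: eq_measure_integral => A mA _.
exact: V_gauss.
Qed.

Lemma Rintegral_cos_lincomb p q (theta : R) : p != 0 -> q != 0 ->
  covf p p = covf q q ->
  \int[P]_t cos (lincomb p t + theta) = \int[P]_t cos (lincomb q t + theta).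
Proof.
move=> p0 q0 pq.
(* Adding 1 makes the integrand nonnegative; the constant cancels at the end. *)
pose g x := 1 + cos (x + theta).
have cg : continuous g.
  move=> x; apply: cvgD; first exact: cvg_cst.
  apply: (@continuous_comp _ _ _ (fun y : R => y + theta) cos); last exact: continuous_cos.
  by apply: cvgD; [exact: cvg_id|exact: cvg_cst].
have g0 x : 0 <= g x by rewrite /g -lerBlDl sub0r cos_geN1.
have E : \int[P]_t g (lincomb p t) = \int[P]_t g (lincomb q t).
  by rewrite /Rintegral !ge0_integral_lincomb// pq.
have Ic w : integrableR (fun t => cos (lincomb w t + theta)).
  apply: (@bdd_integrable _ _ _ _ _ 1) => [|t]; last exact: cos_max.
  apply: measurableT_comp.
    by apply: continuous_measurable_fun; exact: continuous_cos.
  by apply: measurable_funD => //; exact: measurable_lincomb.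
have I1 : integrableR (fun=> 1 : R).
  by apply: (@bdd_integrable _ _ _ _ _ 1) => // t; rewrite normr1.
by move: E; rewrite !RintegralD//; exact: addrI.
Qed.

Let v : R := fine (@normal_moment2 R).

Let v_gt0 : 0 < v.
Proof.
by apply: fine_gt0; rewrite normal_moment2_gt0 normal_moment2_lty.
Qed.

Let vE : (@normal_moment2 R = v%:E)%E.
Proof.
rewrite /v fineK// ge0_fin_numE ?normal_moment2_lty// ltW//.
exact: normal_moment2_gt0.
Qed.

Let integral_lincomb_sq w : (\int[P]_t (lincomb w t ^+ 2)%:E = (v * covf w w)%:E)%E.
Proof.
have [->|w0] := eqVneq w 0.
  rewrite /covform !mul0mx mxE mulr0; apply: integral0_eq => t _.
  by rewrite /lincomb big1 ?expr0n// => i _; rewrite mxE mul0r.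
rewrite (@ge0_integral_lincomb w (fun x => x ^+ 2))//; last 2 first.
- by move=> x; exact: exprn_continuous.
- by move=> x; exact: sqr_ge0.
under eq_integral do rewrite exprMn EFinM.
rewrite ge0_integralZl//.
- by rewrite -/(normal_moment2 R) vE sqr_sqrtr ?covform_ge0// -EFinM mulrC.
- by apply/measurable_EFinP; exact: measurable_funX.
- by move=> x _; rewrite lee_fin sqr_ge0.
Qed.

Let integrable_lincomb_sq w : integrableR (fun t => lincomb w t ^+ 2).
Proof.
apply/integrableP; split.
  by apply/measurable_EFinP; apply: measurable_funX; exact: measurable_lincomb.
under eq_integral do rewrite /= ger0_norm ?sqr_ge0//.
by rewrite integral_lincomb_sq ltry.
Qed.

Lemma integrable_lincombM p q : integrableR (fun t => lincomb p t * lincomb q t).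
Proof.
have Ipq : integrableR (fun t => lincomb p t ^+ 2 + lincomb q t ^+ 2).
  exact: (integrableD measurableT (integrable_lincomb_sq p) (integrable_lincomb_sq q)).
apply: le_integrable Ipq => //.
  by apply/measurable_EFinP; apply: measurable_funM; exact: measurable_lincomb.
move=> t _; rewrite /= lee_fin [leRHS]ger0_norm ?addr_ge0 ?sqr_ge0// normrM.
have := sqr_ge0 (`|lincomb p t| - `|lincomb q t|).
have := mulr_ge0 (normr_ge0 (lincomb p t)) (normr_ge0 (lincomb q t)).
rewrite sqrrB !real_normK ?num_real//; lra.
Qed.

Lemma integrable_lincomb w : integrableR (lincomb w).
Proof.
have I1 : integrableR (fun t => 1 + lincomb w t ^+ 2).
  have I0 : integrableR (fun=> 1 : R).
    by apply: (@bdd_integrable _ _ _ _ _ 1) => // t; rewrite normr1.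
  exact: (integrableD measurableT I0 (integrable_lincomb_sq w)).
apply: le_integrable I1 => //.
  by apply/measurable_EFinP; exact: measurable_lincomb.
move=> t _; rewrite /= lee_fin [leRHS]ger0_norm ?addr_ge0 ?sqr_ge0//.
have := sqr_ge0 (`|lincomb w t| - 1); rewrite sqrrB real_normK ?num_real//.
have := normr_ge0 (lincomb w t); lra.
Qed.

(** Polarisation: second moments are [v] times variances, so expanding the square of the sum leaves
    [v] times the covariance, and [v] is positive. *)
Lemma Rintegral_lincombM_eq0 p q :
  \int[P]_t (lincomb p t * lincomb q t) = 0 -> covf p q = 0.
Proof.
have sq w : \int[P]_t (lincomb w t ^+ 2) = v * covf w w.
  by rewrite /Rintegral integral_lincomb_sq.
have Isq2 : integrableR (fun t => lincomb p t ^+ 2 + lincomb q t ^+ 2).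
  exact: (integrableD measurableT (integrable_lincomb_sq p) (integrable_lincomb_sq q)).
have Ipq2 : integrableR (fun t => 2 * (lincomb p t * lincomb q t)).
  exact: (integrableZl measurableT 2 (integrable_lincombM p q)).
have := sq (p + q).
rewrite (_ : \int[P]_t (lincomb (p + q) t ^+ 2) = \int[P]_t
    (lincomb p t ^+ 2 + lincomb q t ^+ 2 + 2 * (lincomb p t * lincomb q t))); last first.
  by apply: eq_Rintegral => t _; rewrite lincombD; ring.
move=> + pq0; rewrite RintegralD// RintegralD// RintegralZl ?integrable_lincombM// !sq pq0.
rewrite covformDl !covformDr// (covformC Sigma_posdef q p) => h.
have /eqP : v * covf p q = 0 by lra.
by rewrite mulf_eq0 (gt_eqF v_gt0) => /eqP.
Qed.

End gaussian_linear_combinations.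

(** * The sine near zero *)

Section sine_at_zero.
Local Open Scope classical_set_scope.
Variable R : realType.
Implicit Types x : R.

Lemma normr_sin_le x : `|sin x| <= `|x|.
Proof.
have pos (y : R) : 0 <= y -> `|sin y| <= y.
  move=> y0; have [c _] := MVT_segment y0 (fun z _ => @is_derive_sin R z)
    (continuous_subspaceT (@continuous_sin R)).
  rewrite sin0 !subr0 => ->; rewrite normrM (ger0_norm y0).
  by rewrite -[leRHS]mul1r ler_wpM2r// cos_max.
have [x0|x0] := leP 0 x; first by rewrite (ger0_norm x0) pos.
by rewrite (ltr0_norm x0) -normrN -sinN pos// oppr_ge0 ltW.
Qed.

(** x times the difference quotient of the sine at 0 for the increment x / (k + 1). *)
Lemma cvg_scaled_sin x : k.+1%:R * sin (x / k.+1%:R) @[k --> \oo] --> x.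
Proof.
have [->|x0] := eqVneq x 0.
  rewrite (_ : (fun _ => _) = fun=> 0); first exact: cvg_cst.
  by apply/funext => k; rewrite mul0r sin0 mulr0.
have d0 : h^-1 * sin h @[h --> (0 : R)^'] --> (1 : R).
  have := @derivable_sin R 0; rewrite /derivable => /cvg_ex[l] /[dup] hl /cvg_lim.
  have -> : lim (h^-1 *: ((sin \o shift 0) (h *: (1 : R)) - sin 0) @[h --> (0 : R)^']) = 1 :> R.
    by rewrite -[RHS]cos0 -/(derive _ _ _) derive_val.
  move=> /(_ (@norm_hausdorff _ _)) l1; rewrite -l1 in hl.
  apply: cvg_trans hl; apply: near_eq_cvg; apply: nearW => h /=.
  by rewrite sin0 subr0 addr0 [h *: _]mulr1.
have h0 : x / k.+1%:R @[k --> \oo] --> (0 : R)^'.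
  have c0 : x / k.+1%:R @[k --> \oo] --> (0 : R).
    by rewrite -[X in _ --> X](mulr0 x); apply: cvgM; [exact: cvg_cst|exact: cvg_harmonic].
  move=> A A0.
  have cA : \forall k \near \oo, x / k.+1%:R != 0 -> A (x / k.+1%:R) := c0 _ A0.
  have : \forall k \near \oo, A (x / k.+1%:R).
    by apply: filterS cA => k; apply; rewrite mulf_neq0// invr_eq0 pnatr_eq0.
  by [].
have -> : (fun k => k.+1%:R * sin (x / k.+1%:R)) =
    (fun k => x * ((x / k.+1%:R)^-1 * sin (x / k.+1%:R))).
  by apply/funext => k; rewrite invf_div mulrA mulrCA divff// mulr1.
rewrite -[X in _ --> X]mulr1; apply: cvgM; first exact: cvg_cst.
exact: (cvg_comp _ _ h0 d0).
Qed.

End sine_at_zero.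

(** * Residuals are orthogonal to the sigma-algebra of the conditioning components *)

Section orthogonal_residual.
Local Open Scope classical_set_scope.
Context d (T : measurableType d) (R : realType) (P : probability T R).
Variables (n : nat) (V : 'I_n -> {RV P >-> R}) (mu : 'cV[R]_n) (Sigma : 'M[R]_n).
Hypotheses (Sigma_posdef : posdef Sigma) (V_gauss : gaussian_vector V mu Sigma).
Implicit Types (w p q r : 'rV[R]_n) (W : {set 'I_n}).

Local Notation covf := (covform Sigma).
Local Notation integrableR f := (P.-integrable setT (EFin \o f)).
Local Notation lincomb := (lincomb V mu).

Let mlin w : measurable_fun setT (lincomb w) := measurable_lincomb V mu w.

(** As r and w are uncorrelated, w + s r and w - s r have equal variance and hence equal cosine
    integrals. The addition formula turns this equality into E[sin (s U) sin L] = 0; dividing by s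
    and letting s tend to 0 leaves E[U sin L] = 0. *)
Let lincomb_sin0 r w (theta : R) : covf r w = 0 ->
  \int[P]_t (lincomb r t * sin (lincomb w t + theta)) = 0.
Proof.
move=> rw0; have [->|r0] := eqVneq r 0.
  rewrite (_ : \int[P]_t _ = \int[P]_t (0 : R)); first by rewrite Rintegral_cst// mul0r.
  by apply: eq_Rintegral => t _; rewrite /lincomb big1 ?mul0r// => i _; rewrite mxE mul0r.
have msin (f : T -> R) : measurable_fun setT f -> measurable_fun setT (fun t => sin (f t)).
  move=> mf; apply: measurableT_comp mf.
  by apply: continuous_measurable_fun; exact: continuous_sin.
have mcos (f : T -> R) : measurable_fun setT f -> measurable_fun setT (fun t => cos (f t)).
  move=> mf; apply: measurableT_comp mf.
  by apply: continuous_measurable_fun; exact: continuous_cos.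
have rr0 : 0 < covf r r by exact: covform_gt0.
have sin_sin0 (s : R) : s != 0 ->
    \int[P]_t (sin (s * lincomb r t) * sin (lincomb w t + theta)) = 0.
  move=> s0.
  (* The Gaussian hypothesis concerns nonzero rows only; this row is nonzero since its covariance
     with [r] is e times the variance of [r]. *)
  have nz (e : R) : e != 0 -> w + e *: r != 0.
    move=> e0; apply/eqP => we; have : covf (w + e *: r) r = 0.
      by rewrite we /covform !mul0mx mxE.
    rewrite covformDl covformZl (covformC Sigma_posdef w r) rw0 add0r => /eqP.
    by rewrite mulf_eq0 (negbTE e0) gt_eqF.
  have vE (e : R) : covf (w + e *: r) (w + e *: r) = covf w w + e ^+ 2 * covf r r.
    rewrite covformDl !covformDr// !covformZl !covformZr// (covformC Sigma_posdef w r) rw0.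
    ring.
  have := @Rintegral_cos_lincomb _ _ _ _ _ _ _ _ Sigma_posdef V_gauss
    (w + s *: r) (w + (- s) *: r) theta (nz _ s0) (nz (- s) _) _.
  rewrite oppr_eq0 !vE sqrrN => /(_ s0 erefl) E.
  have cosE (e : R) t : cos (lincomb (w + e *: r) t + theta) =
      cos (lincomb w t + theta) * cos (e * lincomb r t) -
      sin (lincomb w t + theta) * sin (e * lincomb r t).
    by rewrite lincombD lincombZ addrAC cosD.
  have I1 e : integrableR (fun t => cos (lincomb w t + theta) * cos (e * lincomb r t)).
    apply: (@bdd_integrable _ _ _ _ _ 1) => [|t].
      by apply: measurable_funM; apply: mcos; [apply: measurable_funD|apply: measurable_funM].
    by rewrite normrM mulr_ile1// cos_max.
  have I2 e : integrableR (fun t => sin (lincomb w t + theta) * sin (e * lincomb r t)).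
    apply: (@bdd_integrable _ _ _ _ _ 1) => [|t].
      by apply: measurable_funM; apply: msin; [apply: measurable_funD|apply: measurable_funM].
    by rewrite normrM mulr_ile1// sin_max.
  move: E; under eq_Rintegral do rewrite cosE.
  under [X in _ = X -> _]eq_Rintegral do rewrite cosE mulNr cosN sinN mulrN opprK.
  rewrite RintegralB// RintegralD// => E.
  under eq_Rintegral do rewrite mulrC.
  lra.
(* Here s = 1 / (k + 1), and |sin x| <= |x| supplies the integrable majorant |U|. *)
apply: (@Rintegral_cvg0 _ _ _ _
  (fun k t => k.+1%:R * sin (lincomb r t / k.+1%:R) * sin (lincomb w t + theta))
  _ (fun t => `|lincomb r t|)).
- move=> k; apply: measurable_funM; last by apply: msin; exact: measurable_funD.
  by apply: measurable_funM => //; apply: msin; exact: measurable_funM.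
- by move=> t; apply: cvgM; [exact: cvg_scaled_sin|exact: cvg_cst].
- by apply: integrable_norm; apply: (integrable_lincomb Sigma_posdef V_gauss).
- move=> k t; rewrite normrM -[leRHS]mulr1 ler_pM// ?sin_max// normrM.
  rewrite (le_trans (ler_wpM2l _ (normr_sin_le _)))// normrM normfV mulrCA divff ?mulr1//.
  by rewrite normr_eq0 pnatr_eq0.
- move=> k; under eq_Rintegral do rewrite -mulrA [_ / _]mulrC.
  rewrite RintegralZl ?sin_sin0 ?mulr0 ?invr_eq0 ?pnatr_eq0//.
  apply: (@bdd_integrable _ _ _ _ _ 1) => [|t].
    by apply: measurable_funM; apply: msin; [apply: measurable_funM|apply: measurable_funD].
  by rewrite normrM mulr_ile1// sin_max.
Qed.

(** A combination uncorrelated with each component in W is uncorrelated with all their combinations,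
    so [lincomb_sin0] supplies every sine that [Rintegral_indic_sigma0] asks for. *)
Lemma Rintegral_lincomb_sigma0 r W H : (forall j, j \in W -> (r *m Sigma) 0 j = 0) ->
  sigma_sub V W H -> \int[P]_t (lincomb r t * \1_H t) = 0.
Proof.
move=> rW; apply: Rintegral_indic_sigma0 => [j||c theta].
- by [].
- exact: integrable_lincomb Sigma_posdef V_gauss _.
pose w : 'rV[R]_n := \sum_j c j *: delta_mx 0 (enum_val j).
have linw t : lincomb w t = \sum_j c j * (V (enum_val j) t - mu (enum_val j) 0).
  rewrite /w; elim/big_ind2: _ => [|x x' y y' <- <-|i _].
  - by rewrite /lincomb big1// => i _; rewrite mxE mul0r.
  - exact: lincombD.
  - by rewrite lincombZ lincomb_delta.
(* [phase] uses the components themselves and [lincomb] the centred ones; the means move into the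
   constant. *)
pose theta' := theta + \sum_j c j * mu (enum_val j) 0.
have phE t : phase (fun i => V (enum_val i)) c theta t = lincomb w t + theta'.
  rewrite linw /theta' addrCA addrC -big_split/=; congr (_ + _).
  by apply: eq_bigr => i _; ring.
under eq_Rintegral do rewrite phE.
apply: lincomb_sin0; rewrite covformC// /w.
elim/big_ind: _ => [|x y x0 y0|j _].
- by rewrite /covform !mul0mx mxE.
- by rewrite covformDl x0 y0 addr0.
- by rewrite covformZl covformC// covform_deltar rW ?mulr0// enum_valP.
Qed.

End orthogonal_residual.

(** * Conditional independence *)

Section conditional_probability.
Local Open Scope classical_set_scope.
Context d (T : measurableType d) (R : realType) (P : probability T R).
Variable G : set (set T).
Hypothesis G_measurable : G `<=` measurable.
Implicit Types (E F : set T) (f : T -> R).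

Local Notation integrableR f := (P.-integrable setT (EFin \o f)).

Lemma Rintegral_indic E : measurable E -> \int[P]_t \1_E t = fine (P E).
Proof. by move=> mE; rewrite /Rintegral integral_indic// setIT. Qed.

Lemma integrable_indicM f E : integrableR f -> measurable E ->
  integrableR (fun t => f t * \1_E t).
Proof.
move=> If mE; apply: (@integrable_bddM _ _ _ _ _ _ 1) => // t.
by rewrite indicE; case: (_ \in _); rewrite ?normr1 ?normr0.
Qed.

Lemma integrable_indicR E : measurable E -> integrableR (\1_E : T -> R).
Proof. by move=> mE; exact: integrable_indic. Qed.

(** The defining property of a conditional probability, in the form of the hypothesis of
    [Rintegral_comp0]. *)
Lemma is_cond_prob_indic E f F : measurable E -> is_cond_prob P G E f -> G F ->
  \int[P]_t ((\1_E t - f t) * \1_F t) = 0.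
Proof.
move=> mE [_ If fE] GF; have mF := G_measurable GF.
transitivity (\int[P]_t (\1_(E `&` F) t - f t * \1_F t)).
  by apply: eq_Rintegral => t _; rewrite mulrBl indicI.
rewrite RintegralB//; [|exact: integrable_indicR (measurableI _ _ mE mF)|exact: integrable_indicM].
rewrite Rintegral_indic; last exact: measurableI.
have := fE _ GF; rewrite integral_mkcond.
rewrite (_ : _ \_ _ = fun t => (f t * \1_F t)%:E).
  by rewrite /Rintegral => ->; rewrite subrr.
by rewrite epatch_indic; apply/funext => t; rewrite /= EFinM.
Qed.

Let ae_le0 (h k : T -> R) : integrableR k -> measurable_fun setT h ->
  (forall t, 0 <= h t <= k t) -> \int[P]_t k t = 0 -> {ae P, forall t, h t = 0}.
Proof.
move=> Ik mh hk k0.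
have mk := integrable_measurable Ik.
have : ae_eq P setT (EFin \o h) (cst 0%E).
  apply/ae_eq_integral_abs => //; first exact/measurable_EFinP.
  apply/eqP; rewrite eq_le; apply/andP; split; last exact: integral_ge0.
  have <- : (\int[P]_t (k t)%:E = 0)%E.
    by rewrite -(fineK (integrable_fin_num measurableT Ik)) -/(Rintegral _ _ _) k0.
  apply: ge0_le_integral => //=.
  - by apply/measurable_EFinP; exact: measurableT_comp.
  - exact/measurable_EFinP.
  - by move=> t _; have /andP[h0 ?] := hk t; rewrite lee_fin ger0_norm.
by apply: filterS => t /(_ I)[].
Qed.

(** The event f > 1 lies in G, so 1_E - f has integral 0 over it although it is negative there;
    hence the event is null. The event f < 0 is treated alike, and clipping to [0, 1] changes [f] on
    a null set only. Bounded versions can be multiplied with any integrable function. *)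
Lemma is_cond_prob_bounded E f : measurable E -> is_cond_prob P G E f ->
  exists2 g, is_cond_prob P G E g & forall t, `|g t| <= 1.
Proof.
move=> mE cf; have [Gf If fE] := cf.
have mf := integrable_measurable If.
have IEf : integrableR (fun t => \1_E t - f t).
  exact: (integrableB measurableT (integrable_indicR mE) If).
have indE01 t : 0 <= (\1_E t : R) <= 1.
  by rewrite indicE ler0n lern1 leq_b1.
have up : {ae P, forall t, f t <= 1}.
  pose F := f @^-1` `]1, +oo[.
  have GF : G F by exact: Gf.
  have mF := G_measurable GF.
  have Ik : integrableR (fun t => (-1) * ((\1_E t - f t) * \1_F t)).
    exact: (integrableZl measurableT (-1) (integrable_indicM IEf mF)).
  have : {ae P, forall t, (f t - 1) * \1_F t = 0}.
    apply: (ae_le0 Ik) => [|t|].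
    - by apply: measurable_funM; [exact: measurable_funB|exact: measurable_indic].
    - rewrite indicE; have [/set_mem|] := boolP (t \in F).
        rewrite /F/= in_itv/= andbT => f1; have := indE01 t.
        by rewrite !mulr1; lra.
      by rewrite !mulr0 lexx.
    - rewrite RintegralZl ?is_cond_prob_indic ?mulr0//.
      exact: integrable_indicM.
  apply: filterS => t; rewrite indicE; have [_|/negP tF] := boolP (t \in F).
    by rewrite mulr1 => /eqP; rewrite subr_eq0 => /eqP ->.
  by move=> _; rewrite leNgt; apply/negP => f1; apply: tF; rewrite inE /F/= in_itv/= f1.
have lo : {ae P, forall t, 0 <= f t}.
  pose F := f @^-1` `]-oo, 0[.
  have GF : G F by exact: Gf.
  have mF := G_measurable GF.
  have Ik : integrableR (fun t => (\1_E t - f t) * \1_F t).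
    exact: integrable_indicM.
  have : {ae P, forall t, - f t * \1_F t = 0}.
    apply: (ae_le0 Ik) => [|t|].
    - by apply: measurable_funM; [exact: measurableT_comp|exact: measurable_indic].
    - rewrite indicE; have [/set_mem|] := boolP (t \in F).
        rewrite /F/= in_itv/= => f1; have := indE01 t.
        by rewrite !mulr1; lra.
      by rewrite !mulr0 lexx.
    - exact: is_cond_prob_indic.
  apply: filterS => t; rewrite indicE; have [_|/negP tF] := boolP (t \in F).
    by rewrite mulr1 => /eqP; rewrite oppr_eq0 => /eqP ->.
  by move=> _; rewrite leNgt; apply/negP => f1; apply: tF; rewrite inE /F/= in_itv/= f1.
pose clip (x : R) := Num.max 0 (Num.min x 1).
have mclip : measurable_fun setT clip by apply: measurable_maxr => //; exact: measurable_minr.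
have clip1 x : `|clip x| <= 1.
  by rewrite ger0_norm /clip ?ge_max ?ge_min ?le_max ?lexx ?ler01 ?orbT.
have mg : measurable_fun setT (fun t => clip (f t)) by exact: measurableT_comp.
exists (fun t => clip (f t)) => //; split.
- move=> A mA; rewrite (_ : _ @^-1` A = f @^-1` (clip @^-1` A))//; apply: Gf.
  by rewrite -[X in measurable X]setTI; exact: mclip.
- by apply: (@bdd_integrable _ _ _ _ _ 1).
- move=> F GF; have mF := G_measurable GF; rewrite -fE//.
  apply: ae_eq_integral => //.
  + by apply/measurable_EFinP; exact: measurable_funTS.
  + by apply/measurable_EFinP; exact: measurable_funTS.
  + apply: filterS2 up lo => t f1 f0 _; congr EFin.
    by rewrite /clip min_l// max_r.
Qed.

End conditional_probability.

Section gaussian_cond_indep.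
Local Open Scope classical_set_scope.
Context d (T : measurableType d) (R : realType) (P : probability T R).
Variables (n : nat) (V : 'I_n -> {RV P >-> R}) (mu : 'cV[R]_n) (Sigma : 'M[R]_n).
Hypotheses (Sigma_posdef : posdef Sigma) (V_gauss : gaussian_vector V mu Sigma).
Implicit Types (u v : 'I_n) (w p q r : 'rV[R]_n) (W X Y : {set 'I_n}).

Local Notation integrableR f := (P.-integrable setT (EFin \o f)).
Local Notation lincomb := (lincomb V mu).

(** The generators of [sigma_sub V W], named so that measurability for it can be stated over a
    [g_sigma_algebraType]. *)
Let gens W : set (set T) := \big[setU/set0]_(i < #|W|)
  preimage_set_system setT (V (enum_val i) : T -> R) measurable.

Lemma sigma_sub_preimage W u (A : set R) : u \in W -> measurable A ->
  sigma_sub V W (V u @^-1` A).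
Proof.
move=> uW mA; apply: sub_sigma_algebra.
rewrite (bigD1 (enum_rank_in uW u))//=; left; exists A => //.
by rewrite enum_rankK_in// setTI.
Qed.

Lemma sigma_sub_measurable W : sigma_sub V W `<=` measurable.
Proof.
apply: smallest_sub; first exact: sigma_algebra_measurable.
apply: (@big_ind _ (fun C : set (set T) => C `<=` measurable)) => //.
  by move=> C D CE DE A [/CE|/DE].
by move=> i _ _ [A mA <-]; exact: measurable_funPT.
Qed.

Lemma sigma_sub_lincomb W w (A : set R) : (forall j, j \notin W -> w 0 j = 0) ->
  measurable A -> sigma_sub V W (lincomb w @^-1` A).
Proof.
move=> wW mA.
suff mw : measurable_fun setT (lincomb w : g_sigma_algebraType (gens W) -> R).
  by have := mw measurableT A mA; rewrite setTI.
apply: measurable_sum => i.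
have [iW|/wW ->] := boolP (i \in W); last first.
  by under eq_fun do rewrite mul0r; exact: measurable_cst.
apply: measurable_funM => //; apply: measurable_funB => //.
by move=> _ B mB; rewrite setTI; exact: sigma_sub_preimage.
Qed.

(** Split the centred V_u into its residual U and a linear function L of W, and let g0 be a version
    of P(F | W) for F generated by Y. Conditional independence makes V_u orthogonal to 1_F - g0, and
    so is L, being measurable for W; moreover U is orthogonal to g0. Hence E[U 1_F] = 0 for all such
    F, and so E[U V_v] = 0 with V_v centred. *)
Lemma cond_indep_partial_cov X Y W u v : cond_indep V X Y W -> u \in X -> v \in Y ->
  partial_cov Sigma u v W = 0.
Proof.
move=> XYW uX vY.
pose G := sigma_sub V W.
have Gm : G `<=` measurable := @sigma_sub_measurable W.
rewrite -(partial_cov_residual Sigma_posdef v (residualP Sigma_posdef u W)).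
move: (residual _ _ _) (residualP Sigma_posdef u W) => r [rW r0].
pose e : 'rV[R]_n := delta_mx 0 u.
pose U := lincomb r; pose Yu := lincomb e; pose L := lincomb (e - r).
have UE t : U t = Yu t - L t.
  have -> : L t = lincomb (e + (-1) *: r) t by rewrite scaleN1r.
  by rewrite lincombD lincombZ /U /Yu; ring.
have IU : integrableR U := integrable_lincomb Sigma_posdef V_gauss r.
have IYu : integrableR Yu := integrable_lincomb Sigma_posdef V_gauss e.
have IL : integrableR L := integrable_lincomb Sigma_posdef V_gauss _.
have LW A : measurable A -> G (L @^-1` A).
  apply: sigma_sub_lincomb => j jW; rewrite mxE [X in _ + X]mxE rW// !mxE eqxx.
  exact: subrr.
have UG H : G H -> \int[P]_t (U t * \1_H t) = 0.
  exact: (Rintegral_lincomb_sigma0 Sigma_posdef V_gauss r0).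
have lin_pre j X' A : j \in X' -> measurable A ->
    sigma_sub V X' (lincomb (delta_mx 0 j) @^-1` A).
  move=> jX' mA; apply: sigma_sub_lincomb => // i iX'; rewrite mxE eqxx /=.
  by case: eqP => // ij; rewrite ij jX' in iX'.
have bM (Z h : T -> R) : integrableR Z -> integrableR h -> (forall t, `|h t| <= 2) ->
    integrableR (fun t => Z t * h t).
  by move=> IZ Ih h2; apply: (integrable_bddM IZ _ h2); exact: integrable_measurable Ih.
have ind1 (E : set T) t : 0 <= (\1_E t : R) <= 1.
  by rewrite indicE ler0n lern1 leq_b1.
have UF F : sigma_sub V Y F -> \int[P]_t (U t * \1_F t) = 0.
  move=> YF; have mF : measurable F := sigma_sub_measurable YF.
  have XT : sigma_sub V X setT.
    by rewrite -(preimage_setT (V u)); exact: sigma_sub_preimage.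
  (* The whole space as the first event only serves to obtain a version of P(F | W), which is then
     made bounded. *)
  have [f0 [g1 [_ cg1 _]]] := XYW setT F XT YF.
  have [g0 cg0 g01] := is_cond_prob_bounded Gm mF cg1.
  have GT : G setT by rewrite -(preimage_setT g0); have [h _ _] := cg0; exact: h.
  have [Gg0 Ig0 _] := cg0.
  have IFg : integrableR (fun t => \1_F t - g0 t).
    exact: (integrableB measurableT (integrable_indicR P mF) Ig0).
  have Fg2 t : `|\1_F t - g0 t| <= 2.
    have := ind1 F t; have := g01 t; rewrite !ler_norml => /andP[? ?] /andP[? ?].
    by apply/andP; split; lra.
  (* The versions [f] and [g] depend on the pair E, F, whereas [g0] is fixed for all E. *)
  have EFg E : sigma_sub V X E -> \int[P]_t ((\1_F t - g0 t) * \1_E t) = 0.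
    move=> XE; have mE : measurable E := sigma_sub_measurable XE.
    have [f [g [cf cg [_ Ifg Efg]]]] := XYW E F XE YF.
    have [Gf If _] := cf; have [Gg Ig _] := cg.
    have IfF : integrableR (fun t => f t * \1_F t) by exact: integrable_indicM.
    have Ifg0 : integrableR (fun t => f t * g0 t).
      by apply: bM => // t; rewrite (le_trans (g01 t))// ler1n.
    have IEg0 : integrableR (fun t => \1_E t * g0 t).
      apply: bM => //; first exact: integrable_indicR.
      by move=> t; rewrite (le_trans (g01 t))// ler1n.
    have IEF : integrableR (fun t => \1_E t * \1_F t).
      by apply: integrable_indicM => //; exact: integrable_indicR.
    (* E[1_E 1_F] = E[f g] = E[f 1_F] = E[f g0] = E[1_E g0] *)
    have E1 : \int[P]_t (\1_E t * \1_F t) = \int[P]_t (f t * g t).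
      transitivity (fine (P (E `&` F))).
        rewrite -Rintegral_indic; last exact: measurableI.
        by apply: eq_Rintegral => t _; rewrite indicI.
      have := Efg _ GT; rewrite setIT => <-; congr fine.
    have E2 : \int[P]_t ((\1_F t - g t) * f t) = 0.
      apply: Rintegral_comp0.
      - exact: (integrableB measurableT (integrable_indicR P mF) Ig).
      - exact: integrable_measurable If.
      - rewrite (_ : (fun t => _) = fun t => f t * \1_F t - f t * g t).
          exact: (integrableB measurableT IfF Ifg).
        by apply/funext => t; ring.
      - by move=> A mA; exact: (is_cond_prob_indic Gm mF cg (Gf _ mA)).
    have E3 : \int[P]_t ((\1_F t - g0 t) * f t) = 0.
      apply: Rintegral_comp0 => //.
      - exact: integrable_measurable If.
      - rewrite (_ : (fun t => _) = fun t => f t * \1_F t - f t * g0 t).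
          exact: (integrableB measurableT IfF Ifg0).
        by apply/funext => t; ring.
      - by move=> A mA; exact: (is_cond_prob_indic Gm mF cg0 (Gf _ mA)).
    have E4 : \int[P]_t ((\1_E t - f t) * g0 t) = 0.
      apply: Rintegral_comp0 => //.
      - exact: (integrableB measurableT (integrable_indicR P mE) If).
      - exact: integrable_measurable Ig0.
      - rewrite (_ : (fun t => _) = fun t => \1_E t * g0 t - f t * g0 t).
          exact: (integrableB measurableT IEg0 Ifg0).
        by apply/funext => t; ring.
      - by move=> A mA; exact: (is_cond_prob_indic Gm mE cf (Gg0 _ mA)).
    move: E2 E3 E4; under eq_Rintegral do rewrite mulrBl ![_ * f _]mulrC.
    rewrite RintegralB// => E2; under eq_Rintegral do rewrite mulrBl ![_ * f _]mulrC.
    rewrite RintegralB// => E3; under eq_Rintegral do rewrite mulrBl.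
    rewrite RintegralB// => E4; under eq_Rintegral do rewrite mulrBl ![_ * \1_E _]mulrC.
    rewrite RintegralB// E1; lra.
  have YuFg : \int[P]_t ((\1_F t - g0 t) * Yu t) = 0.
    apply: Rintegral_comp0 => //.
    - exact: integrable_measurable IYu.
    - by under eq_fun do rewrite mulrC; exact: bM.
    - by move=> A mA; apply: EFg; exact: lin_pre.
  have LFg : \int[P]_t ((\1_F t - g0 t) * L t) = 0.
    apply: Rintegral_comp0 => //.
    - exact: integrable_measurable IL.
    - by under eq_fun do rewrite mulrC; exact: bM.
    - by move=> A mA; exact: (is_cond_prob_indic Gm mF cg0 (LW _ mA)).
  have IUg0 : integrableR (fun t => U t * g0 t).
    by apply: bM => // t; rewrite (le_trans (g01 t))// ler1n.
  have Ug0 : \int[P]_t (U t * g0 t) = 0.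
    apply: Rintegral_comp0 => //.
    - exact: integrable_measurable Ig0.
    - by move=> A mA; exact: UG (Gg0 _ mA).
  (* U 1_F = (1_F - g0) (Yu - L) + U g0, and each of the three terms integrates to zero. *)
  transitivity (\int[P]_t ((\1_F t - g0 t) * Yu t - (\1_F t - g0 t) * L t + U t * g0 t)).
    by apply: eq_Rintegral => t _; rewrite UE; ring.
  have I1 : integrableR (fun t => (\1_F t - g0 t) * Yu t).
    by under eq_fun do rewrite mulrC; exact: bM.
  have I2 : integrableR (fun t => (\1_F t - g0 t) * L t).
    by under eq_fun do rewrite mulrC; exact: bM.
  rewrite RintegralD// ?RintegralB// ?YuFg ?LFg ?Ug0 ?subr0 ?addr0//.
  exact: (integrableB measurableT I1 I2).
rewrite -covform_deltar.
apply: (Rintegral_lincombM_eq0 Sigma_posdef V_gauss).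
apply: Rintegral_comp0 => //.
- exact: measurable_lincomb.
- exact: (integrable_lincombM Sigma_posdef V_gauss).
- by move=> A mA; apply: UF; exact: lin_pre.
Qed.

End gaussian_cond_indep.

(** * Independence as conditional independence given no components *)

Section independence.
Local Open Scope classical_set_scope.
Context d (T : measurableType d) (R : realType) (P : probability T R).
Variables (n : nat) (V : 'I_n -> {RV P >-> R}).
Implicit Types (X Y : {set 'I_n}).

Lemma sigma_sub_set0 : sigma_sub V finset.set0 `<=` [set H | H = set0 \/ H = setT].
Proof.
apply: smallest_sub.
  split=> [|A [->|->]|F FE]; first by left.
  - by right; rewrite setD0.
  - by left; rewrite setDv.
  - have [[i FiT]|FN] := pselect (exists i, F i = setT).
      by right; apply/seteqP; split => // t _; exists i; rewrite ?FiT.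
    left; apply/seteqP; split => // t [i _ Fit].
    have [Fi0|FiT] := FE i; first by rewrite Fi0 in Fit.
    by case: FN; exists i.
apply: (@big_ind _ (fun C : set (set T) => C `<=` [set H | H = set0 \/ H = setT])) => //.
  by move=> C D CE DE A [/CE|/DE].
by move=> i _; have := enum_valP i; rewrite finset.in_set0.
Qed.

Lemma is_cond_prob_set0 (E : set T) : measurable E ->
  is_cond_prob P (sigma_sub V finset.set0) E (fun=> fine (P E)).
Proof.
move=> mE.
have s0 : sigma_sub V finset.set0 set0 by exact: sigma_algebra0.
split.
- move=> A _; have [EA|EA] := pselect (A (fine (P E))).
    rewrite (_ : _ @^-1` A = setT `\` set0); first exact: sigma_algebraCD.
    by rewrite setD0; apply/seteqP; split.
  by rewrite (_ : _ @^-1` A = set0)//; apply/seteqP; split.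
- exact: finite_measure_integrable_cst.
- move=> F /sigma_sub_set0[|] ->; first by rewrite integral_set0 setI0 measure0.
  by rewrite integral_cst// [X in (_ * X)%E](probability_setT P) mule1 setIT fineK// fin_num_measure.
Qed.

(** Over the trivial sigma-algebra the constants P(E), P(F) and P(E) P(F) are versions. With
    [partial_cov0], independence thus yields vanishing entries of Sigma. *)
Lemma indep_cond_indep X Y : indep V X Y -> cond_indep V X Y finset.set0.
Proof.
move=> XY E F XE YF.
have mE : measurable E := sigma_sub_measurable XE.
have mF : measurable F := sigma_sub_measurable YF.
exists (fun=> fine (P E)), (fun=> fine (P F)); split; try exact: is_cond_prob_set0.
rewrite (_ : (fun _ => _) = fun=> fine (P (E `&` F))).
  by apply: is_cond_prob_set0; exact: measurableI.
by apply/funext => _; rewrite XY// fineM// fin_num_measure.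
Qed.

End independence.

(** * The correlation inequalities *)

Theorem theorem4 (d : measure_display) (T : measurableType d) (R : realType)
    (P : probability T R) (n : nat) (V : 'I_n -> {RV P >-> R})
    (mu : 'cV[R]_n) (Sigma : 'M[R]_n)
    (a c z : 'I_n) (B : {set 'I_n}) :
  posdef Sigma -> gaussian_vector V mu Sigma ->
  a != c -> a \notin z |: B -> c \notin z |: B ->
  indep V [set a] [set z] ->
  (exists x : 'I_n,
     (indep V [set c] [set a; z] /\
      (cond_indep V [set a; z] B [set x] \/
       cond_indep V [set a; z] B [set c; x] \/
       cond_indep V [set c; z] B [set x] \/
       cond_indep V [set c; z] B [set a; x] \/
       cond_indep V [set a; c] B [set x] \/
       cond_indep V [set a; c] B [set x; z])) \/
     cond_indep V [set a; z] (c |: B) [set x]) ->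
  sq_partial_corr Sigma a c B <= sq_partial_corr Sigma a c (z |: B) /\
  (forall z' : 'I_n, z' \notin [set a; c] ->
     cond_indep V [set z'] ([set a; c] :|: B) [set z] ->
     sq_partial_corr Sigma a c B <= sq_partial_corr Sigma a c (z' |: B) /\
     sq_partial_corr Sigma a c (z' |: B) <= sq_partial_corr Sigma a c (z |: B)).

Proof.
move=> Spd VG ac azB czB iaz hx.
have pc0 u v (X Y W : {set 'I_n}) : cond_indep V X Y W -> u \in X -> v \in Y ->
    partial_cov Sigma u v W = 0 by exact: (cond_indep_partial_cov Spd VG).
have S0 u v (X Y : {set 'I_n}) : indep V X Y -> u \in X -> v \in Y -> Sigma u v = 0.
  move=> /indep_cond_indep iXY uX vY.
  by rewrite -(partial_cov0 Spd); exact: (pc0 _ _ _ _ _ iXY).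
have SC u v : Sigma u v = Sigma v u by rewrite -[in LHS]Spd.1 mxE.
have az0 : Sigma a z = 0 by apply: (S0 _ _ _ _ iaz); rewrite inE.
(* If x is the only component of W possibly correlated with u or v, [partial_cov0_factor] makes
   their covariances with B proportional. *)
have collinear u v w x (W : {set 'I_n}) :
    Sigma u v = 0 -> Sigma u w = 0 -> Sigma v w = 0 ->
    (forall j, j \in W -> j != x -> Sigma u j = 0 /\ Sigma v j = 0) ->
    cond_indep V [set u; v] B W ->
    partial_cov Sigma u v B * partial_cov Sigma u w B * partial_cov Sigma v w B <= 0.
  move=> uv0 uw0 vw0 W0 uvB; have [y yE] := partial_cov0_factor Sigma x W.
  (* The value 0 at [w] extends the proportionality from B to [w], with which u and v are both
     uncorrelated. *)
  apply: (@partial_cov_collinear_le0 _ _ _ Spd u v w B (Sigma u x) (Sigma v x)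
    (fun j => if j == w then 0 else y j)) => // j; rewrite in_setU1.
    case: eqP => [->|_ /= jB]; first by rewrite uw0 mulr0.
    apply: yE => [i iW ix|]; first by have [] := W0 i iW ix.
    by apply: (pc0 _ _ _ _ _ uvB) => //; rewrite !inE eqxx.
  case: eqP => [->|_ /= jB]; first by rewrite vw0 mulr0.
  apply: yE => [i iW ix|]; first by have [] := W0 i iW ix.
  by apply: (pc0 _ _ _ _ _ uvB) => //; rewrite !inE eqxx orbT.
have prod_le0 : partial_cov Sigma a c B * partial_cov Sigma a z B *
    partial_cov Sigma c z B <= 0.
  have [x [[icaz hxi]|azcB]] := hx.
    have ca0 : Sigma c a = 0 by apply: (S0 _ _ _ _ icaz); rewrite !inE eqxx.
    have cz0 : Sigma c z = 0 by apply: (S0 _ _ _ _ icaz); rewrite !inE eqxx ?orbT.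
    have ac0 : Sigma a c = 0 by rewrite SC.
    have zc0 : Sigma z c = 0 by rewrite SC.
    have za0 : Sigma z a = 0 by rewrite SC.
    (* In each of (a) to (f) the conditioning set holds, besides x, at most the third component,
       uncorrelated with the pair. *)
    have W1 u v : forall j, j \in [set x] -> j != x -> Sigma u j = 0 /\ Sigma v j = 0.
      by move=> j; rewrite inE => ->.
    have W2 w u v : Sigma u w = 0 -> Sigma v w = 0 ->
        forall j, j \in [set w; x] -> j != x -> Sigma u j = 0 /\ Sigma v j = 0.
      by move=> ? ? j; rewrite !inE => /orP[/eqP ->//|->].
    (* The product is symmetric in a, c, z, so any two of them may form the pair. *)
    have azc (W : {set 'I_n}) : (forall j, j \in W -> j != x -> Sigma a j = 0 /\ Sigma z j = 0) ->
        cond_indep V [set a; z] B W -> partial_cov Sigma a c B *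
        partial_cov Sigma a z B * partial_cov Sigma c z B <= 0.
      move=> W0 /(collinear _ _ _ _ _ az0 ac0 zc0 W0).
      by rewrite (partial_covC Spd z c) (mulrC (partial_cov _ a z _)).
    have cza (W : {set 'I_n}) : (forall j, j \in W -> j != x -> Sigma c j = 0 /\ Sigma z j = 0) ->
        cond_indep V [set c; z] B W -> partial_cov Sigma a c B *
        partial_cov Sigma a z B * partial_cov Sigma c z B <= 0.
      move=> W0 /(collinear _ _ _ _ _ cz0 ca0 za0 W0).
      by rewrite (partial_covC Spd z a) (partial_covC Spd c a) -mulrA mulrC.
    have acz (W : {set 'I_n}) : (forall j, j \in W -> j != x -> Sigma a j = 0 /\ Sigma c j = 0) ->
        cond_indep V [set a; c] B W -> partial_cov Sigma a c B *
        partial_cov Sigma a z B * partial_cov Sigma c z B <= 0.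
      by move=> W0 /(collinear _ _ _ _ _ ac0 az0 cz0 W0).
    have [h|[h|[h|[h|[h|h]]]]] := hxi.
    - exact: azc (W1 _ _) h.
    - exact: azc (W2 _ _ _ ac0 zc0) h.
    - exact: cza (W1 _ _) h.
    - exact: cza (W2 _ _ _ ca0 za0) h.
    - exact: acz (W1 _ _) h.
    - by rewrite (finset.setUC [set x]) in h; exact: acz (W2 _ _ _ az0 cz0) h.
  (* In case (ii) one factor [y] serves c as well as B; the pair is a, z and the third component is
     c. *)
  have [y yE] := partial_cov0_factor Sigma x [set x].
  have x1 u : forall j, j \in [set x] -> j != x -> Sigma u j = 0.
    by move=> j; rewrite inE => ->.
  rewrite (partial_covC Spd c z) [X in X * _ <= _]mulrC.
  apply: (@partial_cov_collinear_le0 _ _ _ Spd a z c B (Sigma a x) (Sigma z x) y) => // j jcB;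
    apply: yE (x1 _) _; apply: (pc0 _ _ _ _ _ azcB) => //; by rewrite !inE eqxx ?orbT.
have [le1 le2] := sq_partial_corr_mono Spd azB czB prod_le0.
(* lambda is the regression coefficient of z' on z; independence of z' from j given z means
   Sigma_z'j = lambda Sigma_zj. *)
split=> // z' _ z'z; apply: (le2 z' (Sigma z' z / Sigma z z)) => j.
have zz0 : Sigma z z != 0.
  by rewrite gt_eqF// -(partial_cov0 Spd) partial_cov_gt0// inE.
rewrite in_setU1 => /orP[/eqP ->|jacB]; first by rewrite divfK.
have := pc0 _ _ _ _ _ z'z (set11 z') jacB.
rewrite -[[set z]]finset.setU0 partial_covU1// !partial_cov0// => /eqP.
by rewrite subr_eq0 mulrAC => /eqP.
Qed.
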